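(* (One impurity, scaling limit.) (i) Two-dimensional case: let $G_1=G_1^{sq}(n)=\{(x,y):1\le x,y\le n\}$ with the terminal attached to $(1,1)$, and let $\mathbf P$ be the uniform distribution on the perfect matchings of the corresponding graph $G^{(1)}$, with $I_1$ the position of the impurity as defined in the context. For all $0\le c_1<c_2\le1$ and $0\le d_1<d_2\le 1$, $$\mu([c_1,c_2]\times[d_1,d_2]):=\lim_{n\to\infty}\mathbf P\big(I_1\in[c_1n,c_2n]\times[d_1n,d_2n]\big)$$ exists and equals $\delta_{(0,0)}([c_1,c_2]\times[d_1,d_2])$; i.e. $\mu$ is the delta measure at the origin of $[0,1]^2$. (ii) One-dimensional case: let $G_1=G_1^{ch}(n)=\{1,2,\dots,n\}$ be the one-dimensional chain with the terminal attached to $1$, and let $\mathbf P$ and $I_1$ be defined in the same way. For all $0\le c_1<c_2\le1$, $$\mu([c_1,c_2]):=\lim_{n\to\infty}\mathbf P\big(I_1\in[c_1n,c_2n]\big)$$ exists and equals $\delta_0([c_1,c_2])$; i.e. $\mu$ is the delta measure at the origin of $[0,1]$.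
   Context: Let $p=n$ in the two-dimensional case and $p=1$ in the one-dimensional case. $G_2$ is the square-lattice graph formed by an $(n+1)\times(p+1)$ array of lattice points, so that its $n\cdot p$ bounded faces are unit squares; $G_1$ has these faces as vertices, two being adjacent iff the faces share an edge. The faces are labelled $(x,y)$, $1\le x\le n$, $1\le y\le p$ (in the one-dimensional case just $x\in\{1,\dots,n\}$). Let $f$ be the left boundary edge of $G_2$ incident with the face $t=(1,1)$ (resp. $t=1$), and add a new vertex $T$ (the terminal) joined to $t$ by an edge crossing $f$; the position of $T$ is $(0,1)$ (resp. $0$). The graph $G^{(1)}$ has vertex set $V(G_1)\cup\{T\}\cup V(G_2)\cup\{m_e: e\in E(G_2)\}$ and edges: $m_e$ is joined to both endpoints of $e$; $m_e$ is joined to each bounded face (vertex of $G_1$) incident with $e$; $m_f$ is joined to $T$; (diagonal edges) each face $x\in V(G_1)$ is joined to its four corners in $V(G_2)$, and $T$ is joined to the two endpoints of $f$. A perfect matching is a set of edges covering each vertex exactly once. An impurity of a perfect matching of $G^{(1)}$ is a diagonal edge belonging to it; every perfect matching of $G^{(1)}$ has exactly one impurity, written $\{I_1,I_2\}$ with $I_1\in V(G_1)\cup\{T\}$ and $I_2\in V(G_2)$. The event $I_1\in[c_1n,c_2n]\times[d_1n,d_2n]$ refers to the coordinates of $I_1$. *)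

(* Defs.v *)
From mathcomp Require Import all_boot all_order all_algebra.
From mathcomp Require Import zify.

Set Implicit Arguments.
Unset Strict Implicit.
Unset Printing Implicit Defensive.
Import Order.TTheory GRing.Theory Num.Theory.

Section Graph.
Variables n p : nat.

(* Indices start at 0: the pair (i, j) is the unit square
   [i, i + 1] x [j, j + 1], i.e. the face labelled (i + 1, j + 1). *)
Definition face : finType := ('I_n * 'I_p)%type.

Definition corner : finType := ('I_n.+1 * 'I_p.+1)%type.

(* [inl (i, j)] is the horizontal edge from (i, j) to (i + 1, j) and
   [inr (i, j)] the vertical edge from (i, j) to (i, j + 1). *)
Definition edge : finType := ('I_n * 'I_p.+1 + 'I_n.+1 * 'I_p)%type.

Definition endpoint (e : edge) (v : corner) : bool :=
  match e with
  | inl (i, j) => ((v.1 == i :> nat) || (v.1 == i.+1 :> nat)) && (v.2 == j)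
  | inr (i, j) => (v.1 == i) && ((v.2 == j :> nat) || (v.2 == j.+1 :> nat))
  end.

Definition face_edge (e : edge) (x : face) : bool :=
  match e with
  | inl (i, j) => (i == x.1) && ((j == x.2 :> nat) || (j == x.2.+1 :> nat))
  | inr (i, j) => ((i == x.1 :> nat) || (i == x.1.+1 :> nat)) && (j == x.2)
  end.

Definition face_corner (x : face) (v : corner) : bool :=
  ((v.1 == x.1 :> nat) || (v.1 == x.1.+1 :> nat)) &&
  ((v.2 == x.2 :> nat) || (v.2 == x.2.+1 :> nat)).

(* The edge f crossed by the edge from the terminal T to the face (1, 1). *)
Definition terminal_edge (e : edge) : bool :=
  if e is inr (i, j) then (i == 0 :> nat) && (j == 0 :> nat) else false.

(* V(G_1) with the terminal added: [Some x] is the face x, [None] is T. *)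
Definition site : finType := option face.

Definition site_edge (e : edge) (u : site) : bool :=
  if u is Some x then face_edge e x else terminal_edge e.

Definition site_corner (u : site) (v : corner) : bool :=
  if u is Some x then face_corner x v
  else [exists e, terminal_edge e && endpoint e v].

Definition position (u : site) : nat * nat :=
  if u is Some (i, j) then (i.+1, j.+1) else (0, 1).

(* V(G^(1)); the middle summand consists of the vertices m_e. *)
Definition vertex : finType := (site + edge + corner)%type.
Definition of_site (u : site) : vertex := inl (inl u).
Definition of_edge (e : edge) : vertex := inl (inr e).
Definition of_corner (v : corner) : vertex := inr v.

Definition corner_edges : {set {set vertex}} :=
  [set [set of_edge a.1; of_corner a.2] | a : edge * corner & endpoint a.1 a.2].

Definition site_edges : {set {set vertex}} :=
  [set [set of_edge a.1; of_site a.2] | a : edge * site & site_edge a.1 a.2].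

Definition diagonal_edges : {set {set vertex}} :=
  [set [set of_site a.1; of_corner a.2]
     | a : site * corner & site_corner a.1 a.2].

(* E(G^(1)) *)
Definition graph_edges : {set {set vertex}} :=
  corner_edges :|: site_edges :|: diagonal_edges.

Definition perfect_matching (M : {set {set vertex}}) : bool :=
  (M \subset graph_edges) && [forall v, #|[set e in M | v \in e]| == 1].

Definition perfect_matchings : {set {set {set vertex}}} :=
  [set M | perfect_matching M].

Definition impurities (M : {set {set vertex}}) : {set {set vertex}} :=
  M :&: diagonal_edges.

(* The event "the position of I_1 satisfies A"; by [card_impurities] below
   the witnesses I1 and I2 are unique in a perfect matching. *)
Definition impurity_in (A : pred (nat * nat)) (M : {set {set vertex}}) : bool :=
  [exists I1 : site, exists I2 : corner,
     ([set of_site I1; of_corner I2] \in impurities M) && A (position I1)].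

Definition is_edge_vertex (v : vertex) : bool :=
  if v is inl (inr _) then true else false.

Lemma graph_edge_card e : e \in graph_edges ->
  #|e| = 2 /\ #|[set v in e | is_edge_vertex v]| + (e \in diagonal_edges) = 1.
Proof.
have ndiag (a : edge) (w : vertex) : [set of_edge a; w] \notin diagonal_edges.
  apply/negP => /imsetP[b _ /setP/(_ (of_edge a))].
  by rewrite !inE eqxx.
have card_ev (a : edge) (w : vertex) : ~~ is_edge_vertex w ->
    [set v in [set of_edge a; w] | is_edge_vertex v] = [set of_edge a].
  move=> hw; apply/setP => v; rewrite !inE.
  case: eqVneq => [->|_] //=; case: eqVneq => [->|_] //=.
  exact/negbTE.
rewrite in_setU in_setU -orbA => /or3P[] /imsetP[a aP ->].
- by rewrite (negbTE (ndiag _ _)) card_ev// cards1 cards2.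
- by rewrite (negbTE (ndiag _ _)) card_ev// cards1 cards2.
- have -> : [set of_site a.1; of_corner a.2] \in diagonal_edges by apply/imsetP; exists a.
  rewrite cards2; split=> //.
  rewrite (_ : [set v in _ | _] = set0) ?cards0//.
  apply/setP => v; rewrite !inE.
  by do 2 (case: eqVneq => [->|_] //=).
Qed.

Lemma card_impurities M : perfect_matching M -> #|impurities M| = 1.
Proof.
case/andP => /subsetP MG /forallP cov.
have count (B : {set vertex}) : \sum_(e in M) #|[set v in e | v \in B]| = #|B|.
  under eq_bigr => e _ do rewrite -sum1_card big_mkcond /=.
  rewrite exchange_big /= -sum1_card [RHS]big_mkcond /=; apply: eq_bigr => v _.
  case: ifPn => vB; last by rewrite big1// => e _; rewrite inE (negbTE vB) andbF.
  apply: etrans (eqP (cov v)); rewrite -sum1dep_card [RHS]big_mkcondr /=.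
  by apply: eq_bigr => e _; rewrite inE vB andbT.
have cV : 2 * #|M| = #|[set: vertex]|.
  rewrite -count mulnC -sum_nat_const.
  apply: eq_bigr => e eM; rewrite -(graph_edge_card (MG _ eM)).1.
  by apply: eq_card => v; rewrite !inE andbT.
have cE : #|edge| + #|impurities M| = #|M|.
  have -> : #|edge| = #|[set v | is_edge_vertex v]|.
    rewrite -(card_imset predT (_ : injective of_edge)); last by move=> a b [].
    apply: eq_card => v; rewrite inE; apply/imsetP/idP => [[a _ ->]//|].
    by case: v => [[//|a]|//] _; exists a.
  have -> : #|impurities M| = \sum_(e in M) (e \in diagonal_edges).
    rewrite -sum1_card; under eq_bigl => e do rewrite in_setI.
    by rewrite big_mkcondr; apply: eq_bigr => e _; case: ifP.
  rewrite -count -big_split -sum1_card /=; apply: eq_bigr => e eM.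
  rewrite -(graph_edge_card (MG _ eM)).2.
  by congr (_ + _); apply: eq_card => v; rewrite !inE.
move: cV; rewrite -cE cardsT /vertex /site !card_sum card_option !card_prod !card_ord.
by move: #|_| => k; rewrite !mulnS !mulSn; lia.
Qed.

Section Probability.
Variable R : numFieldType.

Definition matching_prob (E : pred {set {set vertex}}) : R :=
  (#|[set M in perfect_matchings | E M]|%:R / #|perfect_matchings|%:R)%R.

End Probability.
End Graph.

(* Main.v *)
Require Import Defs.
From mathcomp Require Import all_boot all_order all_algebra all_fingroup.
From mathcomp Require Import zify ring lra.

(* Forgetting the impurity {I, c}, a perfect matching assigns to every edge of
   G_2 one of its corners or sites, i.e. it is a nonzero term in the expansion of
   the determinant of the matrix [d | b] of edge-corner and edge-face incidences,
   bordered by one row for c and one for I.  Because d^T b = 0, one gets: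
   - the edges matched to corners form a tree rooted at c: along a cycle, the
     circulation would be b phi, and counting the edges on one side of it
     (phi = 0 or phi <> 0) contradicts the injectivity of [d | b] there;
   - hence all the terms have the same sign, so the number w(I) of matchings with
     impurity {I, c} is a determinant, independent of the choice of c;
   - a linear relation between rows then says that w, as a function of the face I,
     is w(T) times the Green function at t of the Laplacian killed outside G_1.
   Summation by parts against explicit test functions shows in dimension two that
   the sum of w(x, y) (x^2 + y^2) is O(n^2 w(T)), while the sum of w is at least
   of order w(T) log n: the mass at distance of order n is negligible.  In
   dimension one the sum of x w(x) is already at most w(T). *)

Set Implicit Arguments.
Unset Strict Implicit.
Unset Printing Implicit Defensive.
Import Order.TTheory GRing.Theory Num.Theory.
Local Open Scope ring_scope.

(** * Linear algebra over finite index types *)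

(** Why all signs agree: zero the face entries outside the edges that a given matching sends to
    sites. Uniqueness makes that matching the only surviving term, so the term is itself a
    determinant. Multiplied by the transpose of one fixed unmasked matrix, it becomes a product of
    Gram determinants, and the masked one is a square; the sign is therefore that of a fixed
    quantity.

    Why a logarithm: on the quarter plane the Green function at the corner decays like xy / (x^2 +
    y^2)^2, so each dyadic annulus carries mass of order w(T). The macroscopic annuli are negligible
    only because there are about log n annuli in all, which is why the lower bound on the total mass
    is summed over dyadic boxes. *)

Section IndexedMatrices.
Variables (K : fieldType) (N : nat) (W X : finType).
Variables (wv : 'I_N -> W) (xv : 'I_N -> X).
Hypotheses (wv_bij : bijective wv) (xv_bij : bijective xv).
Implicit Types M : W -> X -> K.

(** Rows and columns carry different finite types, so the sign of the determinant depends on the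
    enumerations; [wv] and [xv] stay fixed so that signs can be compared. *)
Definition fmx M : 'M[K]_N := \matrix_(i, j) M (wv i) (xv j).

Lemma fmx_ker_det0 M (u : X -> K) (x0 : X) :
  u x0 != 0 -> (forall w, \sum_x M w x * u x = 0) -> \det (fmx M) = 0.
Proof.
move=> u0 Mu; rewrite -det_tr; apply/eqP/det0P.
exists (\row_j u (xv j)).
  case: xv_bij => xi xiK xK; apply/eqP => /rowP/(_ (xi x0)).
  by rewrite !mxE xK => /eqP; rewrite (negbTE u0).
apply/rowP => i; rewrite !mxE -[RHS](Mu (wv i)).
rewrite [RHS](reindex xv); last exact: onW_bij.
by apply: eq_bigr => j _; rewrite !mxE mulrC.
Qed.

Lemma fmx_lker_det0 M (u : W -> K) (w0 : W) :
  u w0 != 0 -> (forall x, \sum_w u w * M w x = 0) -> \det (fmx M) = 0.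
Proof.
move=> u0 Mu; apply/eqP/det0P; exists (\row_j u (wv j)).
  case: wv_bij => wi wiK wK; apply/eqP => /rowP/(_ (wi w0)).
  by rewrite !mxE wK => /eqP; rewrite (negbTE u0).
apply/rowP => i; rewrite !mxE -[RHS](Mu (xv i)).
rewrite [RHS](reindex wv); last exact: onW_bij.
by apply: eq_bigr => j _; rewrite !mxE.
Qed.

Lemma fmx_det_neq0 M :
  (forall u : X -> K, (forall w, \sum_x M w x * u x = 0) -> forall x, u x = 0) ->
  \det (fmx M) != 0.
Proof.
move=> inj; apply/negP; rewrite -det_tr => /det0P[v v0 vM].
case: xv_bij => xi xiK xK; case: wv_bij => wi wiK wK; case/eqP: v0; apply/rowP => j.
rewrite mxE -(inj (fun x => v 0 (xi x)) _ (xv j)) ?xiK// => w.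
move/rowP/(_ (wi w)): vM; rewrite !mxE => vM; rewrite -[RHS]vM.
rewrite (reindex xv); last exact: onW_bij.
by apply: eq_bigr => k _; rewrite !mxE wK xiK mulrC.
Qed.

Lemma fmx_solve M (g : W -> K) : \det (fmx M) != 0 ->
  exists u : X -> K, forall w, \sum_x M w x * u x = g w.
Proof.
move=> dM; have uM : fmx M \in unitmx by rewrite unitmxE unitfE.
case: xv_bij => xi xiK xK; case: wv_bij => wi wiK wK.
pose v := invmx (fmx M) *m \col_i g (wv i).
exists (fun x => v (xi x) 0) => w.
have /colP/(_ (wi w)) : fmx M *m v = \col_i g (wv i) by rewrite mulKVmx.
rewrite !mxE wK => <-; rewrite (reindex xv); last exact: onW_bij.
by apply: eq_bigr => k _; rewrite !mxE wK xiK.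
Qed.

(** The Leibniz sum has at most one nonzero term. This converts uniqueness statements about
    matchings into values of determinants. *)
Lemma det_fmx_single M (s0 : 'S_N) :
  (forall s : 'S_N, (forall i, M (wv i) (xv (s i)) != 0) -> s = s0) ->
  \det (fmx M) = (-1) ^+ s0 * \prod_i M (wv i) (xv (s0 i)).
Proof.
move=> uniq; rewrite /determinant (bigD1 s0) //= [X in _ + X]big1 ?addr0.
  by congr (_ * _); apply: eq_bigr => i _; rewrite mxE.
move=> s ss0; apply/eqP; rewrite mulf_eq0 signr_eq0 /=; apply/prodf_eq0.
have /existsP[i Mi] : [exists i, M (wv i) (xv (s i)) == 0].
  apply: contraR ss0; rewrite negb_exists => /forallP Ms.
  by apply/eqP; apply: uniq => i; exact: Ms.
by exists i => //; rewrite mxE.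
Qed.

(** One family of cofactors serves every choice of the row [w0], so determinants that differ only
    there can be compared by linearity. *)
Lemma det_fmx_row M (w0 : W) :
  exists cof : X -> K, forall M' : W -> X -> K,
    (forall w x, w != w0 -> M' w x = M w x) ->
    \det (fmx M') = \sum_x M' w0 x * cof x.
Proof.
case: xv_bij => xi xiK xK; case: wv_bij => wi wiK wK.
exists (fun x => cofactor (fmx M) (wi w0) (xi x)) => M' MM'.
rewrite (expand_det_row _ (wi w0)) [RHS](reindex xv) /=; last exact: onW_bij.
apply: eq_bigr => j _; rewrite xiK mxE wK; congr (_ * (_ * \det _)).
apply/matrixP => a b; rewrite !mxE MM' //.
by apply/eqP => /(congr1 wi)/eqP; rewrite wiK eq_sym (negbTE (neq_lift _ _)).
Qed.

Lemma fmx_tr_mul M M' i j :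
  ((fmx M)^T *m fmx M') i j = \sum_w M w (xv i) * M' w (xv j).
Proof.
rewrite mxE [RHS](reindex wv); last exact: onW_bij.
by apply: eq_bigr => k _; rewrite !mxE.
Qed.

End IndexedMatrices.

(** * Comparing cardinalities through the rank of a block *)

Section CardBound.
Variables (K : fieldType) (T1 T2 : finType) (A : {set T1}) (B : {set T2}).
Variable M : T1 -> T2 -> K.
Hypothesis inj : forall u : T1 -> K, (forall a, a \notin A -> u a = 0) ->
  (forall b, b \in B -> \sum_a u a * M a b = 0) -> forall a, u a = 0.

(** Extending vectors by 0 off [A] spares subtypes: [inj] says that the rows of this block are
    independent. *)
Let Q : 'M[K]_(#|A|, #|B|) := \matrix_(i, j) M (enum_val i) (enum_val j).

Let Q_free : row_free Q.
Proof.
apply: inj_row_free => v vQ; apply/rowP => i; rewrite mxE.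
pose u a := \sum_(j < #|A|) if enum_val j == a then v 0 j else 0.
have uE j : u (enum_val j) = v 0 j.
  rewrite /u (bigD1 j) //= eqxx big1 ?addr0// => k kj.
  by case: eqP => // /enum_val_inj kj'; rewrite kj' eqxx in kj.
rewrite -uE; apply: inj => [a aA|b bB].
  rewrite /u big1 // => j _; case: eqP => // ja.
  by rewrite -ja enum_valP in aA.
rewrite (bigID (mem A)) /= [X in _ + X]big1 ?addr0; last first.
  move=> a aA; rewrite /u big1 ?mul0r// => j _; case: eqP => // ja.
  by rewrite -ja enum_valP in aA.
rewrite (big_enum_val (A := mem A)) /=.
move/rowP/(_ (enum_rank_in bB b)): vQ; rewrite !mxE => vQ; rewrite -[RHS]vQ.
by apply: eq_bigr => j _; rewrite uE mxE enum_rankK_in.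
Qed.

Lemma card_le_inj : (#|A| <= #|B|)%N.
Proof. by move: Q_free; rewrite /row_free => /eqP <-; exact: rank_leq_col. Qed.

(** If the cardinalities agreed, [Q] would be invertible, yet it kills the nonzero restriction of
    [w] to [B]. *)
Lemma card_lt_inj (w : T2 -> K) (b0 : T2) : b0 \in B -> w b0 != 0 ->
  (forall a, a \in A -> \sum_(b in B) M a b * w b = 0) -> (#|A| < #|B|)%N.
Proof.
move=> b0B wb0 Mw; rewrite ltn_neqAle card_le_inj andbT; apply/eqP => AB.
have /row_fullP[Q' Q'K] : row_full Q.
  by move: Q_free; rewrite /row_free /row_full => /eqP ->; rewrite AB.
have Qw : Q *m \col_j w (enum_val j) = 0.
  apply/colP => i; rewrite !mxE -[RHS](Mw (enum_val i)) ?enum_valP//.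
  by rewrite [RHS](big_enum_val (A := mem B)); apply: eq_bigr => j _; rewrite !mxE.
have /colP/(_ (enum_rank_in b0B b0)) : \col_j w (enum_val j) = 0 :> 'cV[K]_#|B|.
  by rewrite -[LHS]mul1mx -Q'K -mulmxA Qw mulmx0.
by rewrite !mxE enum_rankK_in // => /eqP; rewrite (negbTE wb0).
Qed.

End CardBound.

(** * The chain complex of the grid *)

Lemma sum_indicator (R : pzSemiRingType) (T : finType) (a : T) (F : T -> R) :
  \sum_x (x == a)%:R * F x = F a.
Proof.
rewrite (bigD1 a) //= eqxx mul1r big1 ?addr0// => x /negbTE ->.
by rewrite mul0r.
Qed.

Lemma inl_eq_inr (T1 T2 : eqType) (a : T1) (b : T2) :
  ((inl a : T1 + T2) == inr b) = false.
Proof. by []. Qed.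

Lemma inr_eq_inl (T1 T2 : eqType) (a : T2) (b : T1) :
  ((inr a : T1 + T2) == inl b) = false.
Proof. by []. Qed.

Section GridComplex.
Variables n p : nat.
Local Notation E := (edge n p).
Local Notation F := (face n p).
Local Notation V := (corner n p).

Definition src (e : E) : V :=
  match e with
  | inl (i, j) => (widen_ord (leqnSn n) i, j)
  | inr (i, j) => (i, widen_ord (leqnSn p) j)
  end.

Definition tgt (e : E) : V :=
  match e with inl (i, j) => (lift ord0 i, j) | inr (i, j) => (i, lift ord0 j) end.

Definition bottom_side (x : F) : E := inl (x.1, widen_ord (leqnSn p) x.2).
Definition top_side (x : F) : E := inl (x.1, lift ord0 x.2).
Definition left_side (x : F) : E := inr (widen_ord (leqnSn n) x.1, x.2).
Definition right_side (x : F) : E := inr (lift ord0 x.1, x.2).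

Definition inc_corner (e : E) (v : V) : rat := (v == tgt e)%:R - (v == src e)%:R.

(** The counterclockwise boundary of the face, for horizontal edges oriented to the right and
    vertical ones upwards. *)
Definition inc_face (e : E) (x : F) : rat :=
  (e == bottom_side x)%:R - (e == top_side x)%:R + (e == right_side x)%:R
  - (e == left_side x)%:R.

Definition grad (psi : V -> rat) (e : E) : rat := \sum_v inc_corner e v * psi v.
Definition rotor (phi : F -> rat) (e : E) : rat := \sum_x inc_face e x * phi x.
Definition divg (g : E -> rat) (v : V) : rat := \sum_e g e * inc_corner e v.
Definition curl (g : E -> rat) (x : F) : rat := \sum_e g e * inc_face e x.

Lemma endpointE e v : endpoint e v = (v == src e) || (v == tgt e).
Proof.
case: e v => -[i j] [a b]; rewrite /endpoint /src /tgt /= !xpair_eqE -!val_eqE /= /bump /=; lia.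
Qed.

Lemma src_neq_tgt e : src e != tgt e.
Proof. by case: e => -[i j]; rewrite /= xpair_eqE -!val_eqE /= /bump /=; lia. Qed.

Lemma inc_corner_neq0 e v : (inc_corner e v != 0) = endpoint e v.
Proof.
rewrite endpointE /inc_corner; have /negbTE th := src_neq_tgt e.
by case: (v =P src e) => [->|_]; rewrite ?th //; case: (v == tgt e).
Qed.

Lemma gradE psi e : grad psi e = psi (tgt e) - psi (src e).
Proof.
rewrite /grad; under eq_bigr => v _ do rewrite mulrBl.
by rewrite big_split sumrN !sum_indicator.
Qed.

Lemma curlE g x :
  curl g x = g (bottom_side x) - g (top_side x) + g (right_side x) - g (left_side x).
Proof.
rewrite /curl; under eq_bigr => e _ do rewrite mulrC mulrBl mulrDl mulrBl.
by rewrite !(big_split, sumrN) /= !sum_indicator.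
Qed.

Lemma curl_grad psi x : curl (grad psi) x = 0.
Proof.
case: x => i j; rewrite curlE !gradE /bottom_side /top_side /left_side /right_side /=.
ring.
Qed.

(* Values on faces extended by 0; the face (x, y) of the paper sits at (x, y). *)
Definition ext (phi : F -> rat) (a b : nat) : rat :=
  \sum_(x : F | (x.1.+1 == a) && (x.2.+1 == b)) phi x.

Lemma ext_face phi (x : F) : ext phi x.1.+1 x.2.+1 = phi x.
Proof.
by rewrite /ext (eq_bigl (pred1 x)) ?big_pred1_eq// => -[i j].
Qed.

Lemma ext_out phi a b : [|| a == 0, b == 0, n < a | p < b]%N -> ext phi a b = 0.
Proof. by move=> ab; rewrite /ext big_pred0// => -[i j] /=; have := ltn_ord i; have := ltn_ord j; lia. Qed.

(** Positions to the left ([side1]) and to the right ([side2]) of the oriented edge; one of them may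
    lie outside the grid, where [ext] is 0. The terminal sits at [side1] of the entrance. *)
Definition side1 (e : E) : nat * nat :=
  match e with inl (i, j) => (i.+1, j.+1) | inr (i, j) => (val i, j.+1) end.
Definition side2 (e : E) : nat * nat :=
  match e with inl (i, j) => (i.+1, val j) | inr (i, j) => (i.+1, j.+1) end.

Lemma rotorE phi e :
  rotor phi e = ext phi (side1 e).1 (side1 e).2 - ext phi (side2 e).1 (side2 e).2.
Proof.
have extE a b (P : pred F) : (forall x, P x = (x.1.+1 == a) && (x.2.+1 == b)) ->
    \sum_x (P x)%:R * phi x = ext phi a b.
  move=> PE; rewrite /ext [RHS]big_mkcond; apply: eq_bigr => x _; rewrite PE.
  by case: ifP; rewrite ?mul1r ?mul0r.
rewrite /rotor; under eq_bigr => x _ do rewrite mulrBl mulrDl mulrBl.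
rewrite !(big_split, sumrN) /=.
have ext0 (P : pred F) : (forall x, P x = false) -> \sum_x (P x)%:R * phi x = 0.
  by move=> P0; rewrite big1 // => x _; rewrite P0 mul0r.
case: e => -[i j]; [set e := inl (i, j)|set e := inr (i, j)].
- rewrite (extE i.+1 j.+1 (fun x => e == bottom_side x)); last first.
    by move=> [a b]; rewrite (inj_eq inl_inj) xpair_eqE -!val_eqE /= /bump /=; lia.
  rewrite (extE i.+1 j (fun x => e == top_side x)); last first.
    by move=> [a b]; rewrite (inj_eq inl_inj) xpair_eqE -!val_eqE /= /bump /=; lia.
  by rewrite (ext0 (fun x => e == right_side x)) ?(ext0 (fun x => e == left_side x)) ?subr0 ?addr0.
- rewrite (extE i j.+1 (fun x => e == right_side x)); last first.
    by move=> [a b]; rewrite (inj_eq inr_inj) xpair_eqE -!val_eqE /= /bump /=; lia.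
  rewrite (extE i.+1 j.+1 (fun x => e == left_side x)); last first.
    by move=> [a b]; rewrite (inj_eq inr_inj) xpair_eqE -!val_eqE /= /bump /=; lia.
  by rewrite (ext0 (fun x => e == bottom_side x)) ?(ext0 (fun x => e == top_side x)) ?subr0 ?add0r.
Qed.

Lemma grad_rot_orth psi phi : \sum_e grad psi e * rotor phi e = 0.
Proof.
rewrite /rotor; under eq_bigr => e _ do rewrite mulr_sumr.
rewrite exchange_big big1 // => x _; under eq_bigr => e _ do rewrite mulrA.
by rewrite -mulr_suml -/(curl _ x) curl_grad mul0r.
Qed.

Lemma grad_eq0 psi : (forall e, grad psi e = 0) -> forall v w, psi v = psi w.
Proof.
move=> g0; suff psi0 v : psi v = psi (ord0, ord0) by move=> v w; rewrite !psi0.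
case: v => i j; transitivity (psi (i, ord0)).
  case: j => j; elim: j => [|j IHj] jp; first by congr (psi (_, _)); exact: val_inj.
  have jp' : (j < p)%N by lia.
  have /eqP := g0 (inr (i, Ordinal jp')); rewrite gradE subr_eq0 /= => /eqP e1.
  rewrite -(IHj (ltnW jp)); apply: etrans (etrans e1 _); congr (psi (_, _));
    exact: val_inj.
case: i => i; elim: i => [|i IHi] ip; first by congr (psi (_, _)); exact: val_inj.
have ip' : (i < n)%N by lia.
have /eqP := g0 (inl (Ordinal ip', ord0)); rewrite gradE subr_eq0 /= => /eqP e1.
rewrite -(IHi (ltnW ip)); apply: etrans (etrans e1 _); congr (psi (_, _));
  exact: val_inj.
Qed.

Lemma rotor_eq0 phi : (forall e, rotor phi e = 0) -> forall x, phi x = 0.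
Proof.
move=> r0 [[i ip] [j jp]]; rewrite -(ext_face phi) /=.
elim: i ip => [|i IHi] ip.
  have /eqP := r0 (inr (ord0, Ordinal jp)); rewrite rotorE subr_eq0 => /eqP /= <-.
  by rewrite ext_out.
have /eqP := r0 (inr (Ordinal (ltnW ip : (i.+1 < n.+1)%N), Ordinal jp)).
by rewrite rotorE subr_eq0 => /eqP /= <-; apply: IHi; exact: ltnW.
Qed.

Lemma grad_rotor_eq0 psi phi : (forall e, grad psi e + rotor phi e = 0) ->
  (forall e, grad psi e = 0) /\ (forall e, rotor phi e = 0).
Proof.
move=> gr; have g0 e : grad psi e = 0.
  have /eqP : \sum_e grad psi e ^+ 2 = 0.
    rewrite -[RHS]oppr0 -[in RHS](grad_rot_orth psi phi) -sumrN; apply: eq_bigr => e' _.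
    by have /eqP := gr e'; rewrite addr_eq0 => /eqP ->; ring.
  rewrite psumr_eq0 => [/allP/(_ e)|*]; last exact: sqr_ge0.
  by rewrite mem_index_enum sqrf_eq0 => /(_ isT)/eqP.
by split=> // e; have := gr e; rewrite g0 add0r.
Qed.

(** The edges at [v] separate the four positions around it. Where such an edge is missing, both its
    sides lie outside the grid and [ext] is 0 on both. *)
Lemma ext_corner phi v : (forall e, endpoint e v -> rotor phi e = 0) ->
  forall a b, (a == v.1 :> nat) || (a == v.1.+1 :> nat) ->
    (b == v.2 :> nat) || (b == v.2.+1 :> nat) ->
  ext phi a b = ext phi v.1.+1 v.2.+1.
Proof.
case: v => [[i ip] [j jp]] /= r0.
have right : ext phi i.+1 j.+1 = ext phi i.+1 j.
  case: (ltnP i n) => ni; last by rewrite !ext_out //; lia.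
  have /eqP : rotor phi (inl (Ordinal ni, Ordinal jp)) = 0 by apply: r0; rewrite /= -!val_eqE /= !eqxx.
  by rewrite rotorE subr_eq0 => /eqP.
have left : ext phi i j.+1 = ext phi i j.
  case: i ip {right} r0 => [|i] ip r0; first by rewrite !ext_out.
  have /eqP : rotor phi (inl (Ordinal (ip : (i < n)%N), Ordinal jp)) = 0 by apply: r0; rewrite /= -!val_eqE /= !eqxx orbT.
  by rewrite rotorE subr_eq0 => /eqP.
have up : ext phi i j.+1 = ext phi i.+1 j.+1.
  case: (ltnP j p) => pj; last by rewrite !ext_out //; lia.
  have /eqP : rotor phi (inr (Ordinal ip, Ordinal pj)) = 0 by apply: r0; rewrite /= -!val_eqE /= !eqxx.
  by rewrite rotorE subr_eq0 => /eqP.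
by move=> a b /orP[]/eqP-> /orP[]/eqP-> //; rewrite -?left -?right ?up.
Qed.

End GridComplex.

(** * The incidence matrix *)

Lemma sum_option (R : nmodType) (T : finType) (h : option T -> R) :
  \sum_x h x = h None + \sum_x h (Some x).
Proof.
rewrite (bigD1 None) //=; congr (_ + _).
rewrite (reindex_omap Some id) /=; last by case.
by apply: eq_bigl => x; rewrite eqxx.
Qed.

Lemma sum_sqr_eq0 (T : finType) (g : T -> rat) :
  \sum_e g e * g e = 0 -> forall e, g e = 0.
Proof.
move=> /eqP; rewrite psumr_eq0 => [/allP h e|e _]; last exact: sqr_ge0.
by have := h e; rewrite mem_index_enum => /(_ isT); rewrite mulf_eq0 orbb => /eqP.
Qed.

Section Incidence.
Variables n p : nat.
Local Notation E := (edge n p).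
Local Notation F := (face n p).
Local Notation V := (corner n p).
Local Notation S := (site n p).

(* The two extra rows record the impurity: [inr false] is matched to its
   corner and [inr true] to its site. *)
Definition row_index : finType := (E + bool)%type.
Definition col_index : finType := (S + V)%type.
Local Notation W := row_index.
Local Notation X := col_index.

(** Euler's relation equates this with the number [#|E| + 2] of rows. The size is written by column
    blocks (corners, faces, terminal) because [tdet_mul] needs a block triangular product. *)
Definition tdim := (#|V| + #|F| + 1)%N.

Lemma card_row : #|W| = tdim.
Proof.
rewrite /tdim /row_index !card_sum card_bool !card_prod !card_ord.
by rewrite !mulnS !mulSn; lia.
Qed.

Definition wv (i : 'I_tdim) : W := enum_val (cast_ord (esym card_row) i).

Definition xv (j : 'I_tdim) : X :=
  match split j with
  | inl k => match split k with
             | inl v => inr (enum_val v)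
             | inr x => inl (Some (enum_val x))
             end
  | inr _ => inl None
  end.

Lemma wv_bij : bijective wv.
Proof.
exists (fun w => cast_ord card_row (enum_rank w)) => [i|w].
  by rewrite /wv enum_valK cast_ordKV.
by rewrite /wv cast_ordK enum_rankK.
Qed.

Lemma xv_bij : bijective xv.
Proof.
pose xi (x : X) : 'I_tdim := match x with
  | inr v => lshift 1 (lshift #|F| (enum_rank v))
  | inl (Some y) => lshift 1 (rshift #|V| (enum_rank y))
  | inl None => rshift (#|V| + #|F|) ord0 end.
exists xi => [j|[[y|]|v]] /=; rewrite /xv.
- case: split_ordP => [k ->|k ->]; last by rewrite (ord1 k).
  by case: split_ordP => [v ->|y ->] /=; rewrite enum_valK.
- by rewrite (unsplitK (inl _)) (unsplitK (inr _)) enum_rankK.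
- by rewrite (unsplitK (inr _)).
- by rewrite (unsplitK (inl _)) (unsplitK (inl _)) enum_rankK.
Qed.

Lemma sum_row (R : nmodType) (h : W -> R) :
  \sum_w h w = \sum_e h (inl e) + (h (inr true) + h (inr false)).
Proof. by rewrite big_sumType /= big_bool. Qed.

Lemma sum_col (R : nmodType) (h : X -> R) :
  \sum_x h x = h (inl None) + \sum_y h (inl (Some y)) + \sum_v h (inr v).
Proof. by rewrite big_sumType /= sum_option. Qed.

Lemma divg_rotor (phi : F -> rat) v : divg (rotor phi) v = 0.
Proof.
rewrite -[RHS](grad_rot_orth (fun w => (w == v)%:R) phi); apply: eq_bigr => e _.
rewrite mulrC; congr (_ * _); rewrite /grad (bigD1 v) //= eqxx mulr1 big1 ?addr0 // => w /negbTE->.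
by rewrite mulr0.
Qed.

Lemma sum_grad_div psi (g : E -> rat) :
  \sum_e g e * grad psi e = \sum_v psi v * divg g v.
Proof.
rewrite /grad; under eq_bigr => e _ do rewrite mulr_sumr.
rewrite exchange_big; apply: eq_bigr => v _; rewrite /divg mulr_sumr.
by apply: eq_bigr => e _; rewrite mulrA mulrC.
Qed.

Lemma sum_rot_curl phi (g : E -> rat) :
  \sum_e g e * rotor phi e = \sum_y phi y * curl g y.
Proof.
rewrite /rotor; under eq_bigr => e _ do rewrite mulr_sumr.
rewrite exchange_big; apply: eq_bigr => v _; rewrite /curl mulr_sumr.
by apply: eq_bigr => e _; rewrite mulrA mulrC.
Qed.

Definition incident (e : E) (x : X) : bool :=
  match x with inl u => site_edge e u | inr v => endpoint e v end.

Definition is_matching (I : S) (c : V) (m : W -> X) : Prop :=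
  [/\ injective m, m (inr false) = inr c, m (inr true) = inl I
    & forall e, incident e (m (inl e))].

Lemma card_col : #|X| = tdim.
Proof. by rewrite /col_index !card_sum card_option /tdim; lia. Qed.

Lemma matching_bij I c m : is_matching I c m -> bijective m.
Proof. by case=> injm _ _ _; apply: inj_card_bij => //; rewrite card_row card_col. Qed.

Lemma endpoint_or (e : E) a b w : endpoint e a -> endpoint e b -> a != b ->
  endpoint e w -> (w == a) || (w == b).
Proof.
rewrite !endpointE => /orP[]/eqP-> /orP[]/eqP->; rewrite ?eqxx // orbC //.
Qed.

(** The factor [inc_corner e b] orients [e] towards [b], so its row becomes a unit flow from [a] to
    [b]. The dual statement for faces is [inc_faceE]. *)
Lemma inc_cornerE (e : E) a b w : endpoint e a -> endpoint e b -> a != b ->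
  inc_corner e b * inc_corner e w = (w == b)%:R - (w == a)%:R.
Proof.
have := src_neq_tgt e; rewrite !endpointE /inc_corner => th.
by move=> /orP[]/eqP-> /orP[]/eqP->; rewrite ?eqxx // => _;
  rewrite ?(negbTE th) 1?[tgt e == _]eq_sym ?(negbTE th) /=; ring.
Qed.

Lemma grad_eq0_endpoint psi (e : E) a b : endpoint e a -> endpoint e b ->
  grad psi e = 0 -> psi a = psi b.
Proof.
rewrite gradE => + + /eqP; rewrite subr_eq0 !endpointE => + + /eqP ht.
by move=> /orP[]/eqP-> /orP[]/eqP->.
Qed.

Lemma inc_face_horizontal i j (y : F) :
  inc_face (inl (i, j)) y =
  (y.1 == i)%:R * ((y.2 == j :> nat)%:R - (y.2.+1 == j :> nat)%:R).
Proof.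
case: y => a b; rewrite /inc_face !(inj_eq inl_inj) !inl_eq_inr !xpair_eqE.
rewrite -!val_eqE /= /bump /= add1n ![(_ == nat_of_ord i)]eq_sym ![(_ == nat_of_ord j)]eq_sym.
by case: (_ == _ :> nat) => /=; ring.
Qed.

Lemma inc_face_vertical i j (y : F) :
  inc_face (inr (i, j)) y =
  (y.2 == j)%:R * ((y.1.+1 == i :> nat)%:R - (y.1 == i :> nat)%:R).
Proof.
case: y => a b; rewrite /inc_face !(inj_eq inr_inj) !inr_eq_inl !xpair_eqE.
rewrite -!val_eqE /= /bump /= add1n ![(_ == nat_of_ord i)]eq_sym ![(_ == nat_of_ord j)]eq_sym.
by case: (nat_of_ord j == _ :> nat); rewrite ?andbT ?andbF /=; ring.
Qed.

Let side_sqr (b j : nat) :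
  ((b == j)%:R - (b.+1 == j)%:R) ^+ 2 = ((j == b) || (j == b.+1))%:R :> rat.
Proof.
rewrite ![j == _]eq_sym; case: (b =P j) => ?; case: (b.+1 =P j) => ? /=; try ring.
by exfalso; lia.
Qed.

Lemma inc_face_sqr (e : E) y : inc_face e y ^+ 2 = (face_edge e y)%:R.
Proof.
case: e y => -[i j] [a b]; rewrite ?inc_face_horizontal ?inc_face_vertical /=.
  rewrite [i == a]eq_sym; case: (a == i); rewrite /= ?mul0r ?expr0n //= mul1r.
  exact: side_sqr.
rewrite andbC [j == b]eq_sym; case: (b == j); rewrite /= ?mul0r ?expr0n //= mul1r.
by rewrite -sqrrN opprB side_sqr.
Qed.

Lemma inc_face_neq0 (e : E) y : (inc_face e y != 0) = face_edge e y.
Proof. by rewrite -sqrf_eq0 inc_face_sqr; case: (face_edge e y). Qed.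

Let side_mul (a b w j : nat) :
  (j == a) || (j == a.+1) -> (j == b) || (j == b.+1) -> a != b ->
  ((b == j)%:R - (b.+1 == j)%:R) * ((w == j)%:R - (w.+1 == j)%:R) =
  (w == b)%:R - (w == a)%:R :> rat.
Proof.
by case/orP=> /eqP ja /orP[]/eqP jb /eqP ab; do !case: eqP => ?; rewrite /=;
  first [ring | exfalso; lia].
Qed.

Lemma inc_faceE (e : E) a b w : face_edge e a -> face_edge e b -> a != b ->
  inc_face e b * inc_face e w = (w == b)%:R - (w == a)%:R.
Proof.
case: e a b w => -[i j] [a1 a2] [b1 b2] [w1 w2] /=.
  case/andP=> /eqP <- a2j /andP[/eqP <- b2j].
  rewrite !inc_face_horizontal /= !xpair_eqE !eqxx /= mul1r -!val_eqE => ab.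
  case: (w1 == i :> nat); rewrite /= ?mul0r ?mulr0 ?subr0 // mul1r.
  exact: side_mul.
case/andP=> a1i /eqP <- /andP[b1i /eqP <-].
rewrite !inc_face_vertical /= !xpair_eqE !eqxx /= mul1r andbT -!val_eqE => ab.
case: (w2 == j :> nat); rewrite /= ?andbF ?andbT ?mul0r ?mulr0 ?subr0 // mul1r.
by rewrite -mulrNN !opprB; apply: side_mul.
Qed.

Lemma inc_corner_sqr (e : E) v : inc_corner e v ^+ 2 = (endpoint e v)%:R.
Proof.
rewrite endpointE /inc_corner; have /negbTE th := src_neq_tgt e.
by case: (v =P src e) => [->|_]; rewrite ?th //=; case: (v == tgt e) => /=; ring.
Qed.

Lemma side1_corner (e : E) v : endpoint e v ->
  (((side1 e).1 == v.1 :> nat) || ((side1 e).1 == v.1.+1 :> nat)) &&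
  (((side1 e).2 == v.2 :> nat) || ((side1 e).2 == v.2.+1 :> nat)).
Proof. by case: e v => -[i j] [a b] /=; rewrite -!val_eqE /=; lia. Qed.

Lemma site_edge_side (e : E) u : site_edge e u ->
  position u = side1 e \/ position u = side2 e.
Proof.
case: u => [[a b]|] /=; last first.
  by case: e => -[i j] //= /andP[/eqP -> /eqP ->]; left.
case: e => -[i j] /=.
  by case/andP=> /eqP -> /orP[]/eqP ->; [left|right].
by case/andP=> + /eqP -> => /orP[]/eqP ->; [right|left].
Qed.

Lemma position_corner (u : S) v : site_corner u v ->
  (((position u).1 == v.1 :> nat) || ((position u).1 == v.1.+1 :> nat)) &&
  (((position u).2 == v.2 :> nat) || ((position u).2 == v.2.+1 :> nat)).
Proof.
case: u v => [[a b]|] [i j] /=; first by rewrite /face_corner /=; lia.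
case/existsP=> -[] [k l] //= /andP[/andP[/eqP k0 /eqP l0]].
by rewrite -!val_eqE /= k0 l0; lia.
Qed.

End Incidence.

(** * The bordered incidence matrix and the Hodge decomposition *)

Section TemperleyMatrix.
Variables (n p : nat) (hp : (0 < p)%N).
Local Notation E := (edge n p).
Local Notation F := (face n p).
Local Notation V := (corner n p).
Local Notation S := (site n p).
Local Notation W := (row_index n p).
Local Notation X := (col_index n p).

Definition entrance : E := inr (ord0, Ordinal hp).

Lemma terminal_edgeE e : terminal_edge e = (e == entrance).
Proof. by case: e => -[i j]; rewrite ?(inj_eq inr_inj) ?xpair_eqE -?val_eqE. Qed.

(** The mask [P] acts on face entries only and serves to isolate single terms; [a = 0] decouples the
    terminal from the edges; the border rows are left free so that the determinant can be used as a
    linear form in them. *)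
Definition tmx (P : pred E) (a : rat) (r1 : V -> rat) (r2 : S -> rat)
    (w : W) (x : X) : rat :=
  match w, x with
  | inl e, inr v => inc_corner e v
  | inl e, inl (Some y) => (P e)%:R * inc_face e y
  | inl e, inl None => (e == entrance)%:R * a
  | inr false, inr v => r1 v
  | inr false, inl _ => 0
  | inr true, inl s => r2 s
  | inr true, inr _ => 0
  end.

Definition tdet (P : pred E) (a : rat) r1 r2 : rat := \det (fmx (@wv n p) (@xv n p) (tmx P a r1 r2)).

Lemma tmx_edge P a r1 r2 (u : X -> rat) e :
  \sum_x tmx P a r1 r2 (inl e) x * u x =
  (e == entrance)%:R * a * u (inl None)
  + (P e)%:R * rotor (fun y => u (inl (Some y))) e + grad (fun v => u (inr v)) e.
Proof.
rewrite sum_col /=; congr (_ + _ + _); rewrite mulr_sumr.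
by apply: eq_bigr => y _; rewrite mulrA.
Qed.

Lemma tmx_row_corner P a r1 r2 (u : X -> rat) :
  \sum_x tmx P a r1 r2 (inr false) x * u x = \sum_v r1 v * u (inr v).
Proof. by rewrite sum_col /= mul0r add0r big1 ?add0r// => y _; rewrite mul0r. Qed.

Lemma tmx_row_site P a r1 r2 (u : X -> rat) :
  \sum_x tmx P a r1 r2 (inr true) x * u x = \sum_s r2 s * u (inl s).
Proof.
rewrite sum_col /= -(sum_option (fun s => r2 s * u (inl s))) [X in _ + X]big1 ?addr0// => v _.
by rewrite mul0r.
Qed.

Definition one_at (T : finType) (x y : T) : rat := (y == x)%:R.

(** The border rows force the value 0 at the terminal and at [c]. The gradient and the rotor left
    over are orthogonal with sum 0, so both vanish. *)
Lemma tdet_neq0 a c : tdet predT a (one_at c) (one_at None) != 0.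
Proof.
apply: (fmx_det_neq0 (@wv_bij n p) (@xv_bij n p)) => u Mu.
have := Mu (inr true); rewrite tmx_row_site sum_indicator => uT.
have := Mu (inr false); rewrite tmx_row_corner sum_indicator => uc.
have [g0 r0] : (forall e, grad (fun v => u (inr v)) e = 0) /\
               (forall e, rotor (fun y => u (inl (Some y))) e = 0).
  apply: grad_rotor_eq0 => e; have := Mu (inl e).
  by rewrite tmx_edge uT mulr0 add0r mul1r addrC.
case=> [[y|]|v] //; first exact: (rotor_eq0 r0).
by rewrite (grad_eq0 g0 v c).
Qed.

(** An injective square matrix is surjective; with [a = 0] the terminal does not enter the edge
    equations. *)
Lemma hodge (g : E -> rat) :
  exists psi phi, forall e, g e = grad psi e + rotor phi e.
Proof.
have [u Mu] := fmx_solve (@wv_bij n p) (@xv_bij n p)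
  (fun w => if w is inl e then g e else 0) (tdet_neq0 0 (ord0, ord0)).
exists (fun v => u (inr v)), (fun y => u (inl (Some y))) => e.
by rewrite -[LHS](Mu (inl e)) tmx_edge mulr0 mul0r add0r mul1r addrC.
Qed.

(** The gradient part is orthogonal to [g] by summation by parts and to the rotor part, hence to
    itself. *)
Lemma div0_rot (g : E -> rat) : (forall v, divg g v = 0) ->
  exists phi, forall e, g e = rotor phi e.
Proof.
move=> dg; have [psi [phi gE]] := hodge g; exists phi => e.
suff -> : g e = 0 + rotor phi e by rewrite add0r.
rewrite gE; congr (_ + _); apply: sum_sqr_eq0 e.
rewrite -[RHS](_ : \sum_e g e * grad psi e = 0); last first.
  by rewrite sum_grad_div big1 // => v _; rewrite dg mulr0.
under [RHS]eq_bigr => e _ do rewrite gE mulrDl [rotor _ _ * _]mulrC.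
by rewrite big_split /= grad_rot_orth addr0.
Qed.

Lemma curl0_grad (g : E -> rat) : (forall y, curl g y = 0) ->
  exists psi, forall e, g e = grad psi e.
Proof.
move=> cg; have [psi [phi gE]] := hodge g; exists psi => e.
suff -> : g e = grad psi e + 0 by rewrite addr0.
rewrite gE; congr (_ + _); apply: sum_sqr_eq0 e.
rewrite -[RHS](_ : \sum_e g e * rotor phi e = 0); last first.
  by rewrite sum_rot_curl big1 // => v _; rewrite cg mulr0.
under [RHS]eq_bigr => e _ do rewrite gE mulrDl.
by rewrite big_split /= grad_rot_orth add0r.
Qed.

End TemperleyMatrix.

(** * Acyclicity *)

Section NoCycle.
Variables (n p : nat) (hp : (0 < p)%N).
Local Notation E := (edge n p).
Local Notation F := (face n p).
Local Notation V := (corner n p).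
Local Notation S := (site n p).
Local Notation W := (row_index n p).
Local Notation X := (col_index n p).
Variables (I : S) (c : V) (m : W -> X) (q : {perm V}).
Hypothesis Ic : site_corner I c.
Hypothesis m_match : is_matching I c m.
Hypothesis q_c : q c = c.
Hypothesis q_end : forall e v, m (inl e) = inr v -> endpoint e (q v).
Variable v0 : V.
Hypothesis q_v0 : q v0 != v0.

Let C := porbit q v0.
Let m_inj : injective m. Proof. by case: m_match. Qed.
Let m_c : m (inr false) = inr c. Proof. by case: m_match. Qed.
Let m_I : m (inr true) = inl I. Proof. by case: m_match. Qed.
Let m_inc e : incident e (m (inl e)). Proof. by case: m_match. Qed.

Let C_v0 : v0 \in C. Proof. exact: porbit_id. Qed.

Let C_q v : (q v \in C) = (v \in C).
Proof. by rewrite /C ![_ \in porbit q v0]porbit_sym -[q v]/((q ^+ 1)%g v) porbit_perm. Qed.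

Let C_moved v : v \in C -> v != q v.
Proof.
case/porbitP=> i ->; rewrite eq_sym; apply: contra q_v0 => /eqP h; apply/eqP.
by apply: (@perm_inj _ (q ^+ i)%g); rewrite -permM -expgS expgSr permM.
Qed.

Let c_notin : c \notin C.
Proof. by apply/negP => /C_moved; rewrite q_c eqxx. Qed.

Let on_cycle (e : E) : bool := if m (inl e) is inr v then v \in C else false.

(** Unit flow along the orbit: an edge matched to [v] carries it from [v] to [q v]. *)
Let circ (e : E) : rat :=
  if m (inl e) is inr v then (v \in C)%:R * inc_corner e (q v) else 0.

Let m_end e v : m (inl e) = inr v -> endpoint e v.
Proof. by move=> me; have := m_inc e; rewrite me. Qed.

Let on_cycle_end e v : on_cycle e -> endpoint e v -> v \in C.
Proof.
rewrite /on_cycle; case me: (m (inl e)) => [//|w] wC ev.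
have := endpoint_or (m_end me) (q_end me) (C_moved wC) ev.
by case/orP=> /eqP-> //; rewrite C_q.
Qed.

Let circ_off e : ~~ on_cycle e -> circ e = 0.
Proof. by rewrite /on_cycle /circ; case: (m _) => // v /negbTE ->; rewrite mul0r. Qed.

Let sum_match (h : X -> rat) : h (inl I) = 0 -> h (inr c) = 0 ->
  \sum_e h (m (inl e)) = \sum_x h x.
Proof.
move=> hI hc; rewrite (reindex m); last exact: (onW_bij _ (matching_bij m_match)).
by rewrite sum_row m_c m_I hI hc !addr0.
Qed.

(** Through the matching this is a sum over corners of the orbit, where reindexing by [q] cancels
    arrivals against departures. *)
Let circ_div w : divg circ w = 0.
Proof.
pose h (x : X) : rat :=
  if x is inr v then (v \in C)%:R * ((w == q v)%:R - (w == v)%:R) else 0.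
rewrite /divg (eq_bigr (fun e => h (m (inl e)))); last first.
  move=> e _; rewrite /circ /h; case me: (m (inl e)) => [u|v]; first by rewrite mul0r.
  case vC: (v \in C); last by rewrite !mul0r.
  by rewrite !mul1r (inc_cornerE w (m_end me) (q_end me) (C_moved vC)).
rewrite sum_match //; last by rewrite /h (negbTE c_notin) mul0r.
rewrite sum_col /= big1 // !add0r.
under eq_bigr => v _ do rewrite mulrBr mulrC [_ * (w == v)%:R]mulrC.
rewrite big_split sumrN /= -[X in X - _](_ : \sum_v (w == v)%:R * (v \in C)%:R = _) ?subrr//.
by rewrite (reindex_inj (@perm_inj _ q)); apply: eq_bigr => v _; rewrite C_q.
Qed.

Let circ_neq0 : exists e, circ e != 0.
Proof.
have [mi miK mK] := matching_bij m_match.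
case mv: (mi (inr v0)) (mK (inr v0)) => [e|[]] mw; last 2 first.
- by rewrite m_I in mw.
- by move: mw c_notin; rewrite m_c => -[->]; rewrite C_v0.
exists e; rewrite /circ mw C_v0 mul1r inc_corner_neq0; exact: q_end.
Qed.

Section Colouring.
Variable phi : F -> rat.
Hypothesis circE : forall e, circ e = rotor phi e.

(** A replacement for the inside and the outside of the cycle that avoids the Jordan curve theorem.
    Looking at the upper right position of a corner is enough: off the cycle all four positions
    around it carry the same value. *)
Let col (x : X) : bool :=
  match x with
  | inl u => ext phi (position u).1 (position u).2 != 0
  | inr v => ext phi v.1.+1 v.2.+1 != 0
  end.

Let colE (e : E) : bool := ext phi (side1 e).1 (side1 e).2 != 0.

Let off_cycle (x : X) : bool := if x is inr v then v \notin C else true.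

Let col_face y : col (inl (Some y)) = (phi y != 0).
Proof. by case: y => a b; rewrite /col /= (ext_face phi (a, b)). Qed.

Let col_None : col (inl None) = false.
Proof. by rewrite /col /= ext_out ?eqxx. Qed.

Let rotor_off e v : v \notin C -> endpoint e v -> rotor phi e = 0.
Proof.
move=> vC ev; rewrite -circE; apply: circ_off; apply: contra vC => ce.
exact: on_cycle_end ev.
Qed.

Let col_incident e x : ~~ on_cycle e -> off_cycle x -> incident e x -> col x = colE e.
Proof.
move=> ce; case: x => [u|v] /=.
  move=> _ /site_edge_side eu; have := circ_off ce; rewrite circE rotorE => /eqP.
  by rewrite subr_eq0 /colE => /eqP h; case: eu => -> //; rewrite h.
move=> vC ev; rewrite /colE; have /andP[h1 h2] := side1_corner ev.
by rewrite -(ext_corner (fun e => @rotor_off e v vC) h1 h2).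
Qed.

Let col_impurity : col (inl I) = col (inr c).
Proof.
rewrite /col; have /andP[h1 h2] := position_corner Ic.
by rewrite (ext_corner (fun e => @rotor_off e c c_notin) h1 h2).
Qed.

(** The colour avoiding the impurity: both [I] and [c] have the other one, so on this side the
    matching pairs edges with sites and corners perfectly. [Bb] below omits the terminal, whose
    column is 0 in [inc]. *)
Let b := ~~ col (inl I).
Let Eb : {set E} := [set e | ~~ on_cycle e && (colE e == b)].
Let Xb : {set X} := [set x | off_cycle x && (col x == b)].
Let Bb : {set X} := Xb :\ inl None.

Let off_match e : off_cycle (m (inl e)) = ~~ on_cycle e.
Proof. by rewrite /off_cycle /on_cycle; case: (m _). Qed.

Let card_Eb : #|Eb| = #|Xb|.
Proof.
rewrite -(card_imset _ (inj_comp m_inj inl_inj)); apply: eq_card => x.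
rewrite !inE; apply/imsetP/andP => [[e]|[xC xb]].
  rewrite inE => /andP[ce eb] ->; rewrite /= off_match; split=> //.
  by rewrite (col_incident ce) ?off_match.
have [mi miK mK] := matching_bij m_match.
case xw: (mi x) (mK x) => [e|[]] mx.
- exists e => //; have ce : ~~ on_cycle e by rewrite -off_match mx.
  by rewrite inE ce -(col_incident ce xC) // -mx.
- by move: xb; rewrite -mx m_I /b; case: (col _).
- by move: xb; rewrite -mx m_c /b col_impurity; case: (col _).
Qed.

Let inc (e : E) (x : X) : rat :=
  match x with
  | inl (Some y) => inc_face e y
  | inl None => 0
  | inr v => inc_corner e v
  end.

(* [u] is the gradient of a function that is 0 on the cycle. *)
Let inc_inj (u : E -> rat) : (forall e, e \notin Eb -> u e = 0) ->
  (forall x, x \in Bb -> \sum_e u e * inc e x = 0) -> forall e, u e = 0.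
Proof.
move=> u0 uB.
have u_col e x : off_cycle x -> col x != b -> incident e x -> ~~ on_cycle e -> u e = 0.
  move=> xC xb ex ce; apply: u0; rewrite inE ce /=.
  by rewrite -(col_incident ce xC ex).
have u_on e : on_cycle e -> u e = 0 by move=> ce; apply: u0; rewrite inE ce.
have u_at e x : off_cycle x -> col x != b -> incident e x -> u e = 0.
  by move=> xC xb ex; case ce: (on_cycle e); [exact: u_on|apply: u_col ex _; rewrite ?ce].
have curl_u y : curl u y = 0.
  case yb: (col (inl (Some y)) == b).
    by apply: (uB (inl (Some y))); rewrite !inE yb.
  rewrite /curl big1 // => e _; case: (eqVneq (inc_face e y) 0) => [->|]; first by rewrite mulr0.
  rewrite inc_face_neq0 => ey; by rewrite (@u_at e (inl (Some y))) ?yb ?mul0r.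
have [psi psiE] := curl0_grad hp curl_u.
pose psi' v := psi v - psi v0.
have psi'E e : u e = grad psi' e by rewrite psiE !gradE /psi'; ring.
(* [u] vanishes on the cycle, so its potential is constant along the orbit and can be normalised to
   0 there. *)
have psi_q v : v \in C -> psi (q v) = psi v.
  move=> vC; have [mi miK mK] := matching_bij m_match.
  case mv: (mi (inr v)) (mK (inr v)) => [e|[]] mw.
  - apply: (@grad_eq0_endpoint _ _ psi e); rewrite ?(q_end mw) ?(m_end mw) //.
    by rewrite -psiE u_on // /on_cycle mw.
  - by rewrite m_I in mw.
  - by move: mw c_notin; rewrite m_c => -[->]; rewrite vC.
have psi'0 v : v \in C -> psi' v = 0.
  case/porbitP=> i ->; apply/eqP; rewrite subr_eq0; apply/eqP.
  elim: i => [|i IHi]; first by rewrite expg0 perm1.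
  by rewrite expgSr permM psi_q // -porbit_sym porbit_perm.
(* [u] is orthogonal to itself: on the cycle [psi'] is 0, and at all other corners [divg u] is 0. *)
apply: sum_sqr_eq0; under eq_bigr => e _ do rewrite {2}psi'E.
rewrite sum_grad_div big1 // => v _; case vC: (v \in C).
  by rewrite psi'0 ?mul0r.
case vb: (col (inr v) == b).
  by rewrite (_ : divg u v = 0) ?mulr0 //; apply: (uB (inr v)); rewrite !inE /= vC vb.
rewrite [divg u v]big1 ?mulr0 // => e _.
case: (eqVneq (inc_corner e v) 0) => [->|]; first by rewrite mulr0.
by rewrite inc_corner_neq0 => ev; rewrite (@u_at e (inr v)) /= ?vC ?vb ?mul0r.
Qed.

(** [card_Eb] fails on either side. Where [phi] is nonzero, [phi] itself is a kernel vector, since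
    [circ] vanishes off the cycle, so [Bb] is strictly larger than [Eb]. Where [phi] is 0, removing
    the terminal makes [Bb] one element too small for injectivity. *)
Lemma colouring_absurd : False.
Proof.
case bE: b.
  have [e ce] := circ_neq0.
  have [y0 y0P] : exists y, phi y != 0.
    apply/existsP; apply: contraR ce; rewrite negb_exists => /forallP phi0.
    rewrite circE /rotor big1 // => y _; move: (phi0 y); rewrite negbK => /eqP ->.
    by rewrite mulr0.
  pose w (x : X) : rat := if x is inl (Some y) then phi y else 0.
  have : (#|Eb| < #|Bb|)%N.
    have BbE y : (inl (Some y) \in Bb) = (phi y != 0).
      by rewrite in_setD1 inE col_face bE eqb_id.
    apply: (card_lt_inj inc_inj (w := w) (b0 := inl (Some y0))) => //; first by rewrite BbE.
    move=> e'; rewrite inE => /andP[ce' _]; rewrite big_mkcond sum_col.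
    rewrite mul0r if_same add0r [X in _ + X]big1 ?addr0; last first.
      by move=> v _; rewrite mulr0 if_same.
    rewrite -[RHS](circ_off ce') circE; apply: eq_bigr => y _.
    by rewrite BbE /w; case: (eqVneq (phi y) 0) => [->|//]; rewrite mulr0.
  by rewrite card_Eb ltnNge subset_leq_card // subD1set.
have := card_le_inj inc_inj; rewrite card_Eb /Bb (cardsD1 (inl None) Xb).
by rewrite inE col_None bE /= add1n ltnn.
Qed.
End Colouring.

Lemma cycle_absurd : False.
Proof. by have [phi phiE] := div0_rot hp circ_div; exact: (colouring_absurd phiE). Qed.
End NoCycle.

(* A nontrivial orbit of [q] would be a cycle of edges, each of them matched to
   one of its corners. *)
Lemma matching_acyclic n p (hp : (0 < p)%N) (I : site n p) (c : corner n p)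
    (m : row_index n p -> col_index n p) (q : {perm corner n p}) :
  site_corner I c -> is_matching I c m -> q c = c ->
  (forall e v, m (inl e) = inr v -> endpoint e (q v)) -> forall v, q v = v.
Proof.
by move=> Ic mm qc qe v; case: (eqVneq (q v) v) => // /(cycle_absurd hp Ic mm qc qe).
Qed.

(** * The matching attached to a spanning tree *)

Section OneMatching.
Variables (n p : nat) (hp : (0 < p)%N).
Local Notation E := (edge n p).
Local Notation F := (face n p).
Local Notation V := (corner n p).
Local Notation S := (site n p).
Local Notation W := (row_index n p).
Local Notation X := (col_index n p).
Local Notation f := (entrance n hp).
Variables (I : S) (c : V) (m : W -> X).
Hypothesis Ic : site_corner I c.
Hypothesis m_match : is_matching I c m.
Variable mi : X -> W.
Hypotheses (mK : cancel m mi) (miK : cancel mi m).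

Let m_inj : injective m. Proof. by case: m_match. Qed.
Let m_c : m (inr false) = inr c. Proof. by case: m_match. Qed.
Let m_I : m (inr true) = inl I. Proof. by case: m_match. Qed.
Let m_inc e : incident e (m (inl e)). Proof. by case: m_match. Qed.
Let mi_c : mi (inr c) = inr false. Proof. by rewrite -m_c mK. Qed.

Definition to_site (e : E) : bool := if m (inl e) is inl _ then true else false.
Local Notation P := to_site.

Let mi_corner v : v != c -> exists2 e, mi (inr v) = inl e & m (inl e) = inr v.
Proof.
move=> vc; case mv: (mi (inr v)) (miK (inr v)) => [e|[]] mw; first by exists e.
  by rewrite m_I in mw.
by move: mw vc; rewrite m_c => -[->]; rewrite eqxx.
Qed.

Let mi_site u : u != I -> exists2 e, mi (inl u) = inl e & m (inl e) = inl u.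
Proof.
move=> uI; case mv: (mi (inl u)) (miK (inl u)) => [e|[]] mw; first by exists e.
  by move: mw uI; rewrite m_I => -[->]; rewrite eqxx.
by rewrite m_c in mw.
Qed.

(** Incidence matrix of the tree: the row of [v] is that of the edge matched to [v], and the row of
    the root [c] evaluates at [c]. *)
Let vmx (v w : V) : rat :=
  if mi (inr v) is inl e then inc_corner e w else (w == c)%:R.

Local Notation vdet := (\det (fmx (@enum_val V V) (@enum_val V V) vmx)).

Let enum_val_V : bijective (@enum_val V V).
Proof. exact: enum_val_bij. Qed.

(** A permutation with a nonzero term fixes [c] and moves every other corner along its matched edge
    or not at all; by acyclicity it is the identity. *)
Let vdet_neq0 : vdet != 0.
Proof.
rewrite (det_fmx_single (s0 := 1%g)).
  rewrite mulf_neq0 ?signr_eq0 //; apply/prodf_neq0 => i _; rewrite perm1 /vmx.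
  case: (eqVneq (enum_val i) c) => [->|vc]; first by rewrite mi_c.
  have [e -> me] := mi_corner vc; rewrite inc_corner_neq0.
  by have := m_inc e; rewrite me.
move=> s s_neq0; pose q0 v := enum_val (s (enum_rank v)).
have q0_inj : injective q0 by move=> v w /enum_val_inj/perm_inj/enum_rank_inj.
pose q := perm q0_inj.
have qv : forall v, q v = v.
  apply: (matching_acyclic hp Ic m_match).
    rewrite permE /q0; have := s_neq0 (enum_rank c); rewrite enum_rankK /vmx mi_c.
    by case: (enum_val _ =P c) => //= _; rewrite eqxx.
  move=> e v me; rewrite permE /q0 -inc_corner_neq0; have := s_neq0 (enum_rank v).
  by rewrite enum_rankK /vmx -me mK.
apply/permP => i; rewrite perm1; apply: enum_val_inj.
by rewrite -[RHS]qv permE /q0 enum_valK.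
Qed.

Lemma tree_connected (psi : V -> rat) :
  psi c = 0 -> (forall e, ~~ P e -> grad psi e = 0) -> forall v, psi v = 0.
Proof.
move=> pc pg v; apply/eqP; apply: contraT => pv; rewrite -(negbTE vdet_neq0); apply/eqP.
apply: (fmx_ker_det0 (@enum_val V V) enum_val_V pv) => w; rewrite /vmx.
case: (eqVneq w c) => [->|wc]; first by rewrite mi_c sum_indicator.
by have [e -> me] := mi_corner wc; apply: pg; rewrite /to_site me.
Qed.

Lemma tree_no_circulation (g : E -> rat) :
  (forall e, P e -> g e = 0) -> (forall v, divg g v = 0) -> forall e, g e = 0.
Proof.
move=> gP gd e; apply/eqP; apply: contraT => ge.
have [v me] : exists v, m (inl e) = inr v.
  case me: (m (inl e)) => [u|v]; last by exists v.
  by rewrite gP ?eqxx // /to_site me in ge.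
rewrite -(negbTE vdet_neq0); apply/eqP.
pose u v : rat := if mi (inr v) is inl e then g e else 0.
have uv : u v != 0 by rewrite /u -me mK.
apply: (fmx_lker_det0 (@enum_val V V) enum_val_V uv) => w.
pose h (r : W) : rat := if r is inl e then g e * inc_corner e w else 0.
rewrite (eq_bigr (fun v => h (mi (inr v)))); last first.
  by move=> v' _; rewrite /u /vmx /h; case: (mi _) => // b; rewrite mul0r.
have : \sum_x h (mi x) = divg g w.
  rewrite -[LHS](_ : \sum_r h r = _); first by rewrite sum_row /= !addr0.
  by rewrite (reindex mi) //; exact: (onW_bij _ (Bijective miK mK)).
rewrite gd big_sumType /= big1 ?add0r// => u' _.
rewrite /h; case mu: (mi (inl u')) => [e'|//]; rewrite gP ?mul0r//.
by rewrite /to_site -mu miK.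
Qed.

(** Tree-cotree duality: a rotor that vanishes on the cotree is a circulation supported on the
    tree. *)
Lemma cotree_inj (phi : F -> rat) :
  (forall e, P e -> rotor phi e = 0) -> forall y, phi y = 0.
Proof.
by move=> r0; apply: rotor_eq0; apply: tree_no_circulation => // v; exact: divg_rotor.
Qed.

Let to_entrance e : incident e (inl None) -> e = f.
Proof. by rewrite /= terminal_edgeE => /eqP. Qed.

(** On tree edges [m2] and [m] differ by a permutation of corners, trivial by acyclicity. On cotree
    edges they differ by the dual flow [g], which has no curl and vanishes on the tree: it is the
    gradient of a constant. *)
Lemma matching_unique m2 : is_matching I c m2 ->
  (forall e y, m2 (inl e) = inl (Some y) -> P e) -> forall w, m2 w = m w.
Proof.
move=> m2_match m2P; have [m2_inj m2_c m2_I m2_inc] := m2_match.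
have m2_corner e : ~~ P e -> exists v, m2 (inl e) = inr v.
  move=> Pe; case m2e: (m2 (inl e)) => [[y|]|v]; last by exists v.
    by rewrite (m2P _ _ m2e) in Pe.
  (* If [m2] matches the terminal to an edge, the terminal is not the impurity, so [m] matches it to
     an edge too, and only the entrance is available. *)
  have ef : e = f by apply: to_entrance; have := m2_inc e; rewrite m2e.
  have NI : None != I.
    by apply/eqP => NI; move: m2e; rewrite NI -m2_I => /m2_inj.
  have [e' _ me'] := mi_site NI.
  have e'f : e' = f by apply: to_entrance; have := m_inc e'; rewrite me'.
  by move: Pe; rewrite /to_site ef -e'f me'.
pose q0 v : V := if m2 (mi (inr v)) is inr w then w else v.
have q0E v : m2 (mi (inr v)) = inr (q0 v).
  rewrite /q0; case: (eqVneq v c) => [->|vc]; first by rewrite mi_c m2_c.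
  have [e -> me] := mi_corner vc.
  by have [|w ->] := m2_corner e; rewrite // /to_site me.
have q0_inj : injective q0.
  move=> v w vw; have : m2 (mi (inr v)) = m2 (mi (inr w)) by rewrite !q0E vw.
  by move/m2_inj/(can_inj miK) => -[].
have qv v : perm q0_inj v = v.
  apply: (matching_acyclic hp Ic m_match) => [|e w me].
    by rewrite permE /q0 mi_c m2_c.
  by rewrite permE; have := m2_inc e; rewrite -[inl e]mK me q0E.
have m2_tree v : m2 (mi (inr v)) = inr v by rewrite q0E -[in RHS](qv v) permE.
have m2_site e : P e -> exists u, m2 (inl e) = inl u.
  move=> Pe; case m2e: (m2 (inl e)) => [u|v]; first by exists u.
  by move: Pe; rewrite -m2_tree in m2e; rewrite /to_site -(m2_inj _ _ (esym m2e)) miK.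
pose g (e : E) : rat :=
  if m (inl e) is inl (Some x) then
    if m2 (inl e) is inl (Some y) then (x != y)%:R * inc_face e y else 0
  else 0.
have gE e w : g e * inc_face e w =
    (m2 (inl e) == inl (Some w))%:R - (m (inl e) == inl (Some w))%:R.
  rewrite /g; have := m_inc e; have := m2_inc e; case me: (m (inl e)) => [[x|]|v] /=.
  - have [|[y|] m2e] := m2_site e; rewrite /to_site ?me // m2e /=.
      case: (eqVneq x y) => [->|xy] ye xe; first by rewrite !mul0r subrr.
      by rewrite mul1r (inc_faceE _ xe ye xy) !(inj_eq inl_inj) !(inj_eq Some_inj) ![_ == w]eq_sym.
    move=> /(to_entrance (e := e)) ef xe; have NI : None != I.
      by apply/eqP => NI; move: m2e; rewrite NI -m2_I => /m2_inj.
    have [e' _ me'] := mi_site NI.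
    have e'f : e' = f by apply: to_entrance; have := m_inc e'; rewrite me'.
    by move: me; rewrite ef -e'f me'.
  - have [|[y|] m2e] := m2_site e; rewrite /to_site ?me // m2e /= => ye ef; last first.
      by rewrite mul0r subrr.
    have NI : None != I.
      by apply/eqP => NI; move: me; rewrite NI -m_I => /m_inj.
    have : exists e', m2 (inl e') = inl None.
      have b2 := matching_bij m2_match; case: b2 => m2i m2K m2iK.
      case mw: (m2i (inl None)) (m2iK (inl None)) => [e'|[]] mw'; first by exists e'.
        by move: mw' NI; rewrite m2_I => -[->]; rewrite eqxx.
      by rewrite m2_c in mw'.
    case=> e' me'; have e'f : e' = f by apply: to_entrance; have := m2_inc e'; rewrite me'.
    by move: m2e; rewrite (to_entrance (e := e) ef) -e'f me'.
  - have [|v' ->] := m2_corner e; first by rewrite /to_site me.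
    by rewrite mul0r !inr_eq_inl subrr.
have cnt m' w : is_matching I c m' ->
    \sum_e (m' (inl e) == inl (Some w))%:R = 1 - (I == Some w)%:R :> rat.
  move=> mm'; have [m'_inj m'_c m'_I _] := mm'.
  have : \sum_r (m' r == inl (Some w))%:R = 1 :> rat.
    rewrite -[RHS](sum_indicator (inl (Some w) : X) (fun _ => 1)).
    rewrite [RHS](reindex m') /=; last exact: (onW_bij _ (matching_bij mm')).
    by apply: eq_bigr => r _; rewrite mulr1.
  by rewrite sum_row m'_c m'_I (inj_eq inl_inj) inr_eq_inl addr0 => /(canRL (addrK _)).
(* Both matchings reach the face [w] equally often: once, or never when [w] is the impurity. *)
have curl_g w : curl g w = 0.
  rewrite /curl (eq_bigr _ (fun e _ => gE e w)) big_split sumrN /=.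
  by rewrite !cnt // subrr.
have [psi psiE] := curl0_grad hp curl_g.
have psi0 : forall v, psi v - psi c = 0.
  apply: tree_connected; first by rewrite subrr.
  move=> e Pe; rewrite (_ : grad _ e = g e); last by rewrite psiE !gradE; ring.
  by rewrite /g; move: Pe; rewrite /to_site; case: (m _).
have g0 e : g e = 0.
  by rewrite psiE gradE; have := psi0 (tgt e); have := psi0 (src e); lra.
case=> [e|[]]; rewrite ?m_c ?m_I ?m2_c ?m2_I //.
case me: (m (inl e)) => [[x|]|v]; last by rewrite -me -[inl e]mK me m2_tree.
  apply/eqP; have /eqP := gE e x; rewrite g0 mul0r me eqxx eq_sym subr_eq0.
  by case: (m2 _ == _).
have [|[y|] m2e] := m2_site e; rewrite /to_site ?me // m2e.
have /eqP := gE e y; rewrite g0 mul0r me m2e eqxx (inj_eq inl_inj) /= subr0 eq_sym.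
by rewrite oner_eq0.
Qed.

End OneMatching.

(** * Signs of the terms *)

Section Determinants.
Variables (n p : nat) (hp : (0 < p)%N).
Local Notation E := (edge n p).
Local Notation F := (face n p).
Local Notation V := (corner n p).
Local Notation S := (site n p).
Local Notation W := (row_index n p).
Local Notation X := (col_index n p).
Local Notation f := (entrance n hp).
Implicit Type P : pred E.

Definition corner_gram (c : V) : 'M[rat]_#|V| :=
  \matrix_(i, j) (\sum_e inc_corner e (enum_val i) * inc_corner e (enum_val j)
                  + one_at c (enum_val i) * one_at c (enum_val j)).

Definition face_gram P : 'M[rat]_#|F| :=
  \matrix_(i, j) \sum_e (P e)%:R * (inc_face e (enum_val i) * inc_face e (enum_val j)).

Let xv_corner v : @xv n p (lshift 1 (lshift #|F| v)) = inr (enum_val v).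
Proof. by rewrite /xv (unsplitK (inl _)) (unsplitK (inl _)). Qed.

Let xv_face y : @xv n p (lshift 1 (rshift #|V| y)) = inl (Some (enum_val y)).
Proof. by rewrite /xv (unsplitK (inl _)) (unsplitK (inr _)). Qed.

Let xv_terminal y : @xv n p (rshift (#|V| + #|F|) y) = inl None.
Proof. by rewrite /xv (unsplitK (inr _)). Qed.

Let orth (y : F) (v : V) : \sum_e inc_face e y * inc_corner e v = 0.
Proof.
rewrite -[RHS](grad_rot_orth (fun w => (w == v)%:R) (fun x => (x == y)%:R)).
apply: eq_bigr => e _; rewrite mulrC /grad /rotor.
by congr (_ * _); rewrite -[LHS](sum_indicator _ (fun z => _ e z)); apply: eq_bigr => z _; rewrite mulrC.
Qed.

(** Orthogonality of rotors and gradients kills the face-corner block, and [a = 0] in the left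
    factor makes the terminal row trivial. The mask then survives only in the face block. *)
Lemma tdet_mul P a c :
  tdet hp predT 0 (one_at c) (one_at None) * tdet hp P a (one_at c) (one_at None) =
  \det (corner_gram c) * \det (face_gram P).
Proof.
rewrite /tdet -[X in X * _]det_tr -det_mulmx; set A := _ *m _.
have AE i j : A i j = \sum_w tmx hp predT 0 (one_at c) (one_at None) w (xv i) *
                            tmx hp P a (one_at c) (one_at None) w (xv j).
  by rewrite fmx_tr_mul //; exact: wv_bij.
clearbody A; move: (A : 'M_(#|V| + #|F| + 1)) AE => {}A AE; rewrite -[A]submxK.
have -> : dlsubmx A = 0.
  apply/matrixP => i j; rewrite !mxE AE xv_terminal sum_row.
  case: (split_ordP j) => j' ->; rewrite ?xv_corner ?xv_face /=.
    rewrite mulr0 mul0r !addr0 big1 // => e _; by rewrite mulr0 mul0r.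
  rewrite mulr0 mul0r !addr0 big1 // => e _; by rewrite mulr0 mul0r.
rewrite det_ublock [X in _ * \det X](_ : _ = 1%:M); last first.
  apply/matrixP => i j; rewrite !ord1 !mxE AE !xv_terminal sum_row /= big1 ?mul0r.
    by rewrite /one_at eqxx add0r addr0 mul1r.
  by move=> e _; rewrite mulr0 mul0r.
rewrite det1 mulr1 -[ulsubmx A]submxK.
have -> : dlsubmx (ulsubmx A) = 0.
  apply/matrixP => i j; rewrite !mxE AE xv_face xv_corner sum_row /=.
  rewrite mulr0 mul0r !addr0 -[RHS](orth (enum_val i) (enum_val j)).
  by apply: eq_bigr => e _; rewrite mul1r.
rewrite det_ublock; congr (_ * _); congr determinant; apply/matrixP => i j.
  by rewrite !mxE AE !xv_corner sum_row /= mul0r add0r.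
rewrite !mxE AE !xv_face sum_row /= !mulr0 !addr0; apply: eq_bigr => e _.
by rewrite mul1r mulrCA.
Qed.

(** The function equal to 1 on corners and 0 on sites is killed by all edge rows and by the
    difference of the two corner rows. *)
Lemma tdet_corner a (c c' : V) (r2 : S -> rat) :
  tdet hp predT a (one_at c) r2 = tdet hp predT a (one_at c') r2.
Proof.
have [cof cofE] := det_fmx_row (@wv_bij n p) (@xv_bij n p)
  (tmx hp predT a (one_at c) r2) (inr false).
have tE r1 : tdet hp predT a r1 r2 = \sum_v r1 v * cof (inr v).
  rewrite /tdet cofE; first by rewrite (sum_col (fun x => _ x * cof x)) /= mul0r big1 ?add0r// => y _; rewrite mul0r.
  by move=> [e|[]] [[y|]|v].
have /eqP : tdet hp predT a (fun v => one_at c v - one_at c' v) r2 = 0.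
  apply: (fmx_ker_det0 _ (@xv_bij n p) (u := fun x => if x is inr _ then 1 else 0)
    (x0 := inr (ord0, ord0))) => // -[e|[]].
  - rewrite tmx_edge mulr0 add0r mul1r gradE subrr addr0 /rotor big1 // => y _.
    by rewrite mulr0.
  - by rewrite tmx_row_site big1 // => s _; rewrite mulr0.
  - rewrite tmx_row_corner; under eq_bigr => v _ do rewrite mulr1 -[one_at c _]mulr1 -[one_at c' _]mulr1.
    by rewrite big_split sumrN /= !sum_indicator subrr.
rewrite !tE; under eq_bigr => v _ do rewrite mulrBl.
by rewrite big_split sumrN /= subr_eq0 => /eqP.
Qed.

Lemma tmx_neq0_matching P I c (m : W -> X) : injective m ->
  (forall w, tmx hp P 1 (one_at c) (one_at I) w (m w) != 0) -> is_matching I c m.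
Proof.
move=> m_inj m_neq0.
have one_neq0 (T : finType) (x y : T) : one_at x y != 0 -> y = x.
  by rewrite /one_at; case: (y =P x) => //= _; rewrite eqxx.
split=> //.
- by have := m_neq0 (inr false); rewrite /=; case: (m _) => [u|v /one_neq0->//]; rewrite eqxx.
- by have := m_neq0 (inr true); rewrite /=; case: (m _) => [u /one_neq0->//|v]; rewrite eqxx.
- move=> e; have := m_neq0 (inl e); rewrite /=; case: (m _) => [[y|]|v] /=.
  + by rewrite mulf_eq0 negb_or inc_face_neq0 => /andP[].
  + by rewrite (terminal_edgeE hp); case: (e == f); rewrite ?mul0r ?eqxx.
  + by rewrite inc_corner_neq0.
Qed.

Lemma matching_tmx_neq0 I c (m : W -> X) : is_matching I c m ->
  forall w, tmx hp predT 1 (one_at c) (one_at I) w (m w) != 0.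
Proof.
case=> _ m_c m_I m_inc [e|[]]; rewrite ?m_c ?m_I /= /one_at ?eqxx //.
have := m_inc e; case: (m _) => [[y|]|v] /= ev.
- by rewrite mul1r inc_face_neq0.
- by rewrite -(terminal_edgeE hp) ev.
- by rewrite inc_corner_neq0.
Qed.

End Determinants.

Section TermSign.
Variables (n p : nat) (hp : (0 < p)%N).
Local Notation E := (edge n p).
Local Notation F := (face n p).
Local Notation V := (corner n p).
Local Notation S := (site n p).
Local Notation W := (row_index n p).
Local Notation X := (col_index n p).
Local Notation f := (entrance n hp).
Variables (I : S) (c : V) (m : W -> X).
Hypothesis Ic : site_corner I c.
Hypothesis m_match : is_matching I c m.
Variable mi : X -> W.
Hypotheses (mK : cancel m mi) (miK : cancel mi m).
Local Notation P := (to_site m).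

Let m_c : m (inr false) = inr c. Proof. by case: m_match. Qed.
Let m_I : m (inr true) = inl I. Proof. by case: m_match. Qed.

(* The site whose edge is assigned to the face [y]: when the impurity is a
   face, that face takes over the edge of the terminal. *)
Let repr_site (y : F) : S := if I == Some y then None else Some y.
Let r (y : F) : E := if mi (inl (repr_site y)) is inl e then e else f.

Let m_r y : m (inl (r y)) = inl (repr_site y).
Proof.
have NI : repr_site y != I.
  by rewrite /repr_site; case: (eqVneq I (Some y)) => [->//|]; rewrite eq_sym.
rewrite /r; case mv: (mi (inl (repr_site y))) (miK (inl (repr_site y))) => [e|[]] //.
  by rewrite m_I => -[/esym/eqP]; rewrite (negbTE NI).
by rewrite m_c.
Qed.

Let r_inj : injective r.
Proof.
move=> y z yz; have : m (inl (r y)) = m (inl (r z)) by rewrite yz.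
rewrite !m_r /repr_site => -[].
case: (I =P Some y) => Iy; case: (I =P Some z) => Iz //; last by case.
by move=> _; rewrite Iy in Iz; case: Iz.
Qed.

Let r_onto e : P e = (e \in r @: setT).
Proof.
apply/idP/imsetP => [|[y _ ->]]; last by rewrite /to_site m_r.
rewrite /to_site; case me: (m (inl e)) => [u|//] _.
have uI : u != I.
  apply/eqP => uI; have : m (inl e) = m (inr true) by rewrite me m_I uI.
  by move/(can_inj mK).
suff [y yu] : exists y, repr_site y = u.
  exists y => //; have : m (inl e) = m (inl (r y)) by rewrite me m_r yu.
  by move/(can_inj mK) => [].
rewrite /repr_site; case: u uI {me} => [x|] uI.
  by exists x; rewrite eq_sym (negbTE uI).
by case: I uI => [y|//] _; exists y; rewrite eqxx.
Qed.

Let sum_r (R : pzSemiRingType) (h : E -> R) : \sum_e (P e)%:R * h e = \sum_y h (r y).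
Proof.
transitivity (\sum_(e in r @: setT) h e).
  rewrite [RHS]big_mkcond; apply: eq_bigr => e _; rewrite r_onto.
  by case: (_ \in _); rewrite ?mul1r ?mul0r.
rewrite big_imset /=; last by move=> y z _ _; exact: r_inj.
by apply: eq_bigl => y; rewrite inE.
Qed.

Let bmx (y x : F) : rat := inc_face (r y) x.
Local Notation B := (fmx (@enum_val F F) (@enum_val F F) bmx).

(** [r] enumerates the cotree edges by faces, so [B] is square and the masked Gram matrix is its
    transpose times [B]. *)
Let face_gram_sqr : \det (face_gram P) = (\det B) ^+ 2.
Proof.
rewrite expr2 -[X in X * _]det_tr -det_mulmx; congr (\det _).
apply/matrixP => i j; rewrite mxE sum_r fmx_tr_mul //; exact: enum_val_bij.
Qed.

Let det_B : \det B != 0.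
Proof.
have eb : bijective (@enum_val F F) by exact: enum_val_bij.
apply: (fmx_det_neq0 eb eb) => phi phi0.
apply: (cotree_inj hp Ic m_match mK miK) => e; rewrite r_onto => /imsetP[y _ ->].
exact: phi0.
Qed.

Let tree_solution : exists phi, forall e, P e -> rotor phi e = (e == f)%:R.
Proof.
have eb : bijective (@enum_val F F) by exact: enum_val_bij.
have [phi phiE] := fmx_solve eb eb (fun y => (r y == f)%:R) det_B.
by exists phi => e; rewrite r_onto => /imsetP[y _ ->]; rewrite -phiE.
Qed.

(** Extension by 0 commutes with a polynomial that vanishes at 0. *)
Let ext_poly (phi : F -> rat) a b :
  ext (fun x => phi x * (phi x + 1)) a b = ext phi a b * (ext phi a b + 1).
Proof.
case: (boolP [|| a == 0, b == 0, n < a | p < b]%N) => ab.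
  by rewrite !ext_out // mul0r.
case: a b ab => [|a] [|b] //=; rewrite negb_or -!leqNgt => /andP[an bp].
by have := ext_face _ (Ordinal an, Ordinal bp) => /= h; rewrite !h.
Qed.

(* [phi] is constant along cotree edges except for a jump at the entrance, so
   it is the opposite of the indicator of a subtree. *)
Let tree_solution_values phi : (forall e, P e -> rotor phi e = (e == f)%:R) ->
  forall y, phi y = 0 \/ phi y = -1.
Proof.
move=> phiE y; pose phi' x := phi x * (phi x + 1).
have : phi' y = 0.
  apply: (cotree_inj hp Ic m_match mK miK) => e /phiE; rewrite !rotorE !ext_poly.
  case: (eqVneq e f) => [->|_]; last by move/eqP; rewrite subr_eq0 => /eqP ->; rewrite subrr.
  rewrite /= (ext_out phi (a := 0)) // sub0r => /eqP; rewrite eqr_oppLR => /eqP ->.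
  by ring.
move=> /eqP; rewrite mulf_eq0 addr_eq0 => /orP[]/eqP; [left|right]; done.
Qed.

(** For a face impurity [y], the vector with [phi] on faces, -1 at the terminal and 0 on corners is
    in the kernel once the site row is [one_at (Some y) + phi y * one_at None]. By linearity the two
    determinants have ratio [- phi y], which is 0 or 1. *)
Let tdet_root : tdet hp P 1 (one_at c) (one_at I) != 0 ->
  tdet hp P 1 (one_at c) (one_at I) = tdet hp P 1 (one_at c) (one_at None).
Proof.
case IE: I => [y|//]; have [phi phiE] := tree_solution.
have [cof cofE] := det_fmx_row (@wv_bij n p) (@xv_bij n p)
  (tmx hp P 1 (one_at c) (one_at I)) (inr true).
have tE r2 : tdet hp P 1 (one_at c) r2 = \sum_s r2 s * cof (inl s).
  rewrite /tdet cofE; last by move=> [e|[]] [[z|]|v].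
  by rewrite big_sumType /= [X in _ + X]big1 ?addr0 // => v _; rewrite mul0r.
have /eqP : tdet hp P 1 (one_at c) (fun s => one_at (Some y) s + phi y * one_at None s) = 0.
  apply: (fmx_ker_det0 _ (@xv_bij n p)
    (u := fun x : X => match x with inl (Some x) => phi x | inl None => -1 | inr _ => 0 end)
    (x0 := inl None)) => // -[e|[]].
  - rewrite tmx_edge gradE subrr addr0 mulr1 mulrN1.
    case Pe: (P e); first by rewrite mul1r phiE // addNr.
    rewrite mul0r addr0; case: (eqVneq e f) => [ef|_]; last by rewrite oppr0.
    (* The terminal is not the impurity, so it is matched to the entrance, which is thus a cotree
       edge. *)
    have := m_r y; rewrite /repr_site IE eqxx => mf.
    have [_ _ _ /(_ (r y))] := m_match; rewrite mf /= (terminal_edgeE hp) => /eqP rf.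
    by move: Pe; rewrite ef -rf /to_site mf.
  - pose U (s : S) := if s is Some x then phi x else -1.
    rewrite tmx_row_site (eq_bigr (fun s => (s == Some y)%:R * U s
      + phi y * ((s == None)%:R * U s))); last by move=> s _; rewrite /one_at mulrDl mulrA.
    by rewrite big_split -mulr_sumr /= !sum_indicator mulrN1 addrN.
  - by rewrite tmx_row_corner big1 // => v _; rewrite mulr0.
rewrite !tE; under eq_bigr => s _ do rewrite mulrDl -mulrA.
rewrite big_split -mulr_sumr /= !sum_indicator addr_eq0 => /eqP ->.
by have [->|->] := tree_solution_values phiE y; rewrite ?mul0r ?oppr0 ?eqxx // mulN1r opprK.
Qed.

Variable s0 : 'S_(tdim n p).
Hypothesis s0E : forall i, xv (s0 i) = m (wv i).

Let term : rat := (-1) ^+ s0 *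
  \prod_i tmx hp predT 1 (one_at c) (one_at I) (wv i) (xv (s0 i)).

Let term_tdet : term = tdet hp P 1 (one_at c) (one_at I).
Proof.
rewrite /tdet (det_fmx_single (s0 := s0)).
  congr (_ * _); apply: eq_bigr => i _; rewrite s0E /tmx.
  case: (wv i) => [e|//]; case me: (m _) => [[y|]|v] //.
  by rewrite /to_site me.
move=> s s_neq0; have [wi wiK wK] := @wv_bij n p; have [xi xiK xK] := @xv_bij n p.
pose m2 w := xv (s (wi w)).
have m2_neq0 w : tmx hp P 1 (one_at c) (one_at I) w (m2 w) != 0.
  by have := s_neq0 (wi w); rewrite wK.
have m2P e y : m2 (inl e) = inl (Some y) -> P e.
  move=> m2e; have := m2_neq0 (inl e); rewrite m2e /=.
  by case: (P e); rewrite ?mul0r ?eqxx.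
have m2_match : is_matching I c m2.
  apply: tmx_neq0_matching m2_neq0.
  by move=> w w' /(can_inj xiK)/perm_inj/(can_inj wK).
apply/permP => i; apply: (can_inj xiK); rewrite s0E.
by rewrite -(matching_unique hp Ic m_match mK miK m2_match m2P) /m2 wiK.
Qed.

Let term_sqr : term ^+ 2 = 1.
Proof.
have [_ _ _ m_inc] := m_match.
rewrite exprMn sqrr_sign mul1r -prodrXl big1 // => i _.
rewrite s0E; case: (wv i) => [e|[]]; rewrite ?m_c ?m_I /= /one_at ?eqxx ?expr1n //.
have := m_inc e; case: (m _) => [[y|]|v] /= ev.
- by rewrite mul1r inc_face_sqr ev.
- by rewrite -(terminal_edgeE hp) ev mulr1 expr1n.
- by rewrite inc_corner_sqr ev.
Qed.

(** The right side mentions neither [m] nor [I] nor [c]. [D0 * term] and [D0 * D0] share the factor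
    [\det (corner_gram c)]; eliminating it shows that [term * (D0 * L)] is a nonzero square, and
    [term] is 1 or -1. *)
Lemma term_sign :
  (-1) ^+ s0 * \prod_i tmx hp predT 1 (one_at c) (one_at I) (wv i) (xv (s0 i)) =
  Num.sg (tdet hp predT 0 (one_at ((ord0, ord0) : V)) (one_at None) * \det (face_gram (@predT E))).
Proof.
rewrite -/term (tdet_corner hp 0 _ c).
set D0 := tdet _ _ _ _ _; set L := \det _.
have B_neq0 := det_B; have D0_neq0 : D0 != 0 by exact: tdet_neq0.
have term_neq0 : term != 0 by rewrite -sqrf_eq0 term_sqr oner_neq0.
have h1 : D0 * term = \det (corner_gram c) * (\det B) ^+ 2.
  by rewrite -face_gram_sqr -(tdet_mul hp P 1) -tdet_root -term_tdet.
have h2 : D0 * D0 = \det (corner_gram c) * L by exact: tdet_mul.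
have h3 : 0 < term * (D0 * L).
  have -> : term * (D0 * L) = (D0 * \det B) ^+ 2.
    by rewrite mulrCA mulrA h1 mulrAC -h2; ring.
  by rewrite lt_neqAle sqr_ge0 eq_sym sqrf_eq0 mulf_neq0.
have : term = 1 \/ term = -1.
  by have /eqP := term_sqr; rewrite sqrf_eq1 => /orP[]/eqP; [left|right].
case=> term1; move: h3; rewrite term1 ?mul1r ?mulN1r ?oppr_gt0 => h.
  by rewrite gtr0_sg.
by rewrite ltr0_sg.
Qed.
End TermSign.

(** * Weights as determinants *)

Section Counting.
Variables (n p : nat) (hp : (0 < p)%N).
Local Notation E := (edge n p).
Local Notation F := (face n p).
Local Notation V := (corner n p).
Local Notation S := (site n p).
Local Notation W := (row_index n p).
Local Notation X := (col_index n p).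
Local Notation f := (entrance n hp).

Definition matchingb (I : S) (c : V) (m : {ffun W -> X}) : bool :=
  [&& injectiveb m, m (inr false) == inr c, m (inr true) == inl I
    & [forall e, incident e (m (inl e))]].

Lemma matchingP I c (m : {ffun W -> X}) : reflect (is_matching I c m) (matchingb I c m).
Proof.
apply: (iffP and4P) => [[/injectiveP mi /eqP mc /eqP mI /forallP me]|[mi mc mI me]].
  by split.
by split; [exact/injectiveP|exact/eqP|exact/eqP|exact/forallP].
Qed.

Definition tsign : rat :=
  Num.sg (tdet hp predT 0 (one_at ((ord0, ord0) : V)) (one_at None)
          * \det (face_gram (@predT E))).

(** The origin may be used even when it is not a corner of [I], by [tdet_corner]. The lock keeps
    simplification from unfolding the determinant. *)
Definition weight (I : S) : rat :=
  locked (tsign * tdet hp predT 1 (one_at ((ord0, ord0) : V)) (one_at I)).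

Lemma weightE I c : site_corner I c -> weight I = #|[set m | matchingb I c m]|%:R.
Proof.
move=> Ic; rewrite /weight -lock (tdet_corner hp 1 _ c).
have [wi wiK wK] := @wv_bij n p; have [xi xiK xK] := @xv_bij n p.
pose A := [set s : 'S_(tdim n p) |
  [forall i, tmx hp predT 1 (one_at c) (one_at I) (wv i) (xv (s i)) != 0]].
pose h (s : 'S_(tdim n p)) : {ffun W -> X} := [ffun w => xv (s (wi w))].
have h_inj : injective h.
  move=> s t /ffunP st; apply/permP => i; apply: (can_inj xiK).
  by have := st (wv i); rewrite !ffunE wiK.
have AE s : (s \in A) = matchingb I c (h s).
  rewrite inE; apply/forallP/matchingP => [s_neq0|s_match i].
    apply: (tmx_neq0_matching (hp := hp) (P := predT)) => [w w'|w].
      by rewrite !ffunE => /(can_inj xiK)/perm_inj/(can_inj wK).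
    by rewrite ffunE -{1}(wK w); exact: s_neq0.
  by have := matching_tmx_neq0 hp s_match (wv i); rewrite ffunE wiK.
have -> : [set m | matchingb I c m] = h @: A.
  apply/setP => m; rewrite inE; apply/idP/imsetP => [mm|[s]]; last by rewrite AE => + ->.
  have /matchingP[m_inj _ _ _] := mm.
  have s_inj : injective (fun i => xi (m (wv i))).
    by move=> i j /(can_inj xK)/m_inj/(can_inj wiK).
  have hs : h (perm s_inj) = m by apply/ffunP => w; rewrite ffunE permE xK wK.
  by exists (perm s_inj); rewrite ?AE hs.
rewrite card_imset // /tdet /determinant mulr_sumr (bigID (mem A)) /=.
rewrite [X in _ + X]big1 ?addr0 => [|s]; last first.
  rewrite inE negb_forall => /existsP[i]; rewrite negbK => /eqP si.
  by rewrite (bigD1 i) //= mxE si mul0r !mulr0.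
rewrite -sumr_const; apply: eq_bigr => s; rewrite AE => /matchingP sm.
have := sm; case/matching_bij => mi mK miK.
under eq_bigr => i _ do rewrite mxE.
rewrite (@term_sign n p hp I c (h s) Ic sm mi mK miK); last by move=> i; rewrite ffunE wiK.
(* Each surviving term equals [tsign], so the product is 1 as soon as [tsign] is nonzero. *)
rewrite -/tsign -expr2 sqr_sg mulf_neq0 ?tdet_neq0 //.
apply/negP => /eqP d0; have := tdet_mul hp predT 0 ((ord0, ord0) : V).
by rewrite d0 mulr0 => /eqP; rewrite mulf_eq0 orbb; apply/negP; exact: tdet_neq0.
Qed.

Lemma face_has_corner (y : F) :
  site_corner (Some y) (widen_ord (leqnSn n) y.1, widen_ord (leqnSn p) y.2).
Proof. by rewrite /= /face_corner /= !eqxx. Qed.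

Lemma terminal_has_corner : site_corner (None : S) ((ord0, ord0) : V).
Proof.
by apply/existsP; exists f; rewrite (terminal_edgeE hp) eqxx.
Qed.

Lemma weight_ge0 I : 0 <= weight I.
Proof.
by case: I => [y|]; rewrite (weightE (face_has_corner _), weightE terminal_has_corner) ler0n.
Qed.

(** Positivity follows from invertibility, without exhibiting a matching. *)
Lemma weight_terminal_gt0 : 0 < weight None.
Proof.
rewrite lt_neqAle weight_ge0 andbT eq_sym /weight -lock mulf_neq0 ?tdet_neq0 // sgr_eq0.
rewrite mulf_neq0 ?tdet_neq0 //.
apply/negP => /eqP d0; have := tdet_mul hp predT 0 ((ord0, ord0) : V).
by rewrite d0 mulr0 => /eqP; rewrite mulf_eq0 orbb; apply/negP; exact: tdet_neq0.
Qed.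

(* The row of the matrix indexed by sites obtained by adding up the edge rows
   with coefficients [rotor w] is a relation between the weights. *)
Lemma weight_laplacian (w : F -> rat) (t : F) : t.1 = 0%N :> nat -> t.2 = 0%N :> nat ->
  \sum_y weight (Some y) * curl (rotor w) y = weight None * w t.
Proof.
move=> t1 t2; set c0 := ((ord0, ord0) : V).
have [cof cofE] := det_fmx_row (@wv_bij n p) (@xv_bij n p)
  (tmx hp predT 1 (one_at c0) (one_at None)) (inr true).
have tE r2 : tdet hp predT 1 (one_at c0) r2 = \sum_s r2 s * cof (inl s).
  rewrite /tdet cofE; last by move=> [e|[]] [[z|]|v].
  by rewrite big_sumType /= [X in _ + X]big1 ?addr0 // => v _; rewrite mul0r.
pose r2 (s : S) := if s is Some y then curl (rotor w) y else rotor w f.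
have d0 : tdet hp predT 1 (one_at c0) r2 = 0.
  apply: (fmx_lker_det0 (@xv n p) (@wv_bij n p)
    (u := fun w0 : W => match w0 with inl e => rotor w e | inr b => if b then -1 else 0 end)
    (w0 := inr true)) => // -[[y|]|v]; rewrite sum_row /=.
  - rewrite mul0r addr0 mulN1r; apply/eqP; rewrite subr_eq0; apply/eqP.
    by apply: eq_bigr => e _; rewrite mul1r.
  - rewrite mul0r addr0 mulN1r; apply/eqP; rewrite subr_eq0; apply/eqP.
    by under eq_bigr => e _ do rewrite mulr1 mulrC; rewrite sum_indicator.
  - by rewrite mul0r mulr0 !addr0 -[LHS]/(divg (rotor w) v) divg_rotor.
have wE s : weight s = tsign * cof (inl s) by rewrite /weight -lock tE sum_indicator.
(* Left of the entrance [ext] is 0, so its rotor is [- w t]: this is the source term at [t]. *)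
move: d0; rewrite tE sum_option /= rotorE /= (ext_out w (a := 0)) // sub0r.
have -> : ext w 1 1 = w t by rewrite -(ext_face w t) t1 t2.
move=> /eqP; rewrite mulNr addrC subr_eq0 => /eqP d0.
rewrite wE -mulrA [cof _ * _]mulrC -d0 mulr_sumr; apply: eq_bigr => y _.
by rewrite wE -mulrA [cof _ * _]mulrC.
Qed.

End Counting.

(** * Perfect matchings *)

Section Matchings.
Variables (n p : nat) (hp : (0 < p)%N).
Local Notation E := (edge n p).
Local Notation F := (face n p).
Local Notation V := (corner n p).
Local Notation S := (site n p).
Local Notation W := (row_index n p).
Local Notation X := (col_index n p).
Local Notation Vx := (vertex n p).
Implicit Types M : {set {set Vx}}.

Definition col_vertex (x : X) : Vx :=
  match x with inl u => of_site u | inr v => of_corner v end.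

Lemma col_vertex_inj : injective col_vertex.
Proof. by move=> [u|v] [u'|v'] //= [->]. Qed.

Lemma col_vertex_neq x (e : E) : (of_edge e == col_vertex x) = false.
Proof. by case: x => [u|v]; apply/negbTE/eqP. Qed.

Lemma perfect_subset M a : perfect_matching M -> a \in M -> a \in graph_edges n p.
Proof. by case/andP=> /subsetP MG _; exact: MG. Qed.

Lemma perfect_cover M v : perfect_matching M -> exists2 a, a \in M & v \in a.
Proof.
case/andP=> _ /forallP/(_ v)/cards1P[a aE]; exists a.
  by have := set11 a; rewrite -aE inE => /andP[].
by have := set11 a; rewrite -aE inE => /andP[].
Qed.

Lemma perfect_unique M v a b : perfect_matching M ->
  a \in M -> b \in M -> v \in a -> v \in b -> a = b.
Proof.
case/andP=> _ /forallP/(_ v)/cards1P[x xE] aM bM va vb.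
have : a \in [set x] by rewrite -xE inE aM.
have : b \in [set x] by rewrite -xE inE bM.
by rewrite !inE => /eqP-> /eqP->.
Qed.

Lemma graph_edge_cases a : a \in graph_edges n p ->
  (exists e x, incident e x /\ a = [set of_edge e; col_vertex x]) \/
  a \in diagonal_edges n p.
Proof.
rewrite in_setU in_setU -orbA => /or3P[] /imsetP[b]; rewrite inE => bP ->.
- by left; exists b.1, (inr b.2).
- by left; exists b.1, (inl b.2).
- by right; apply/imsetP; exists b; rewrite ?inE.
Qed.

Lemma incident_edge e x : incident e x ->
  [set of_edge e; col_vertex x] \in graph_edges n p.
Proof.
rewrite !in_setU; case: x => [u|v] /= ex; apply/orP; left; apply/orP; [right|left];
  apply/imsetP; [exists (e, u)|exists (e, v)]; by rewrite ?inE.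
Qed.

Definition impurity_edge (I : S) (c : V) : {set Vx} := [set of_site I; of_corner c].

Lemma impurity_edge_inj I c I' c' : impurity_edge I c = impurity_edge I' c' ->
  I = I' /\ c = c'.
Proof.
move=> h; split.
  by have : of_site I \in impurity_edge I' c'; [rewrite -h !inE eqxx|rewrite !inE => /orP[]/eqP // [->]].
by have : of_corner c \in impurity_edge I' c'; [rewrite -h !inE eqxx orbT|rewrite !inE => /orP[]/eqP // [->]].
Qed.

Lemma edge_notin_impurity (e : E) I c : (of_edge e \in impurity_edge I c) = false.
Proof. by apply/negbTE; rewrite !inE negb_or; apply/andP; split; apply/eqP. Qed.

Definition matching_edges (I : S) (c : V) (m : W -> X) : {set {set Vx}} :=
  impurity_edge I c |: [set [set of_edge e; col_vertex (m (inl e))] | e : E].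

Section FromFunction.
Variables (I : S) (c : V).
Hypothesis Ic : site_corner I c.

Lemma in_impurity_edge x : (col_vertex x \in impurity_edge I c) = (x == inl I) || (x == inr c).
Proof. by rewrite !inE -(inj_eq col_vertex_inj) -[x == inr c](inj_eq col_vertex_inj). Qed.

Lemma matching_edges_perfect m : is_matching I c m -> perfect_matching (matching_edges I c m).
Proof.
move=> mm; have [m_inj m_c m_I m_inc] := mm; have [mi mK miK] := matching_bij mm.
apply/andP; split.
  apply/subsetP => a; rewrite !inE => /orP[/eqP->|/imsetP[e _ ->]].
    by rewrite -!in_setU in_setU; apply/orP; right; apply/imsetP; exists (I, c); rewrite ?inE.
  by have := incident_edge (m_inc e); rewrite !inE.
apply/forallP => v; apply/cards1P.
have [[e ->]|[x ->]] : (exists e, v = of_edge e) \/ (exists x, v = col_vertex x).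
  case: v => [[u|e]|c']; [right; by exists (inl u)|left; by exists e|right; by exists (inr c')].
- exists [set of_edge e; col_vertex (m (inl e))]; apply/setP => a.
  rewrite [LHS]inE [RHS]inE; apply/andP/eqP => [[]|->]; last first.
    by split; [rewrite !inE; apply/orP; right; apply: imset_f|rewrite !inE eqxx].
  rewrite !inE => /orP[/eqP->|/imsetP[e' _ ->]].
    by rewrite !inE => /orP[]/eqP.
  by rewrite !inE col_vertex_neq orbF => /eqP[->].
- case xIc: ((x == inl I) || (x == inr c)).
    exists (impurity_edge I c); apply/setP => a.
    rewrite [LHS]inE [RHS]inE; apply/andP/eqP => [[]|->]; last first.
      by rewrite in_impurity_edge xIc !inE eqxx.
    rewrite !inE => /orP[/eqP-> //|/imsetP[e' _ ->]].
    rewrite !inE eq_sym col_vertex_neq (inj_eq col_vertex_inj) => /eqP xe.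
    by move: xIc; rewrite xe -m_I -m_c !(inj_eq m_inj).
  have [e xe] : exists e, x = m (inl e).
    case xw: (mi x) (miK x) => [e|[]] <-; first by exists e.
      by move: xIc; rewrite -[x]miK xw m_I eqxx.
    by move: xIc; rewrite -[x]miK xw m_c eqxx orbT.
  exists [set of_edge e; col_vertex (m (inl e))]; apply/setP => a.
  rewrite [LHS]inE [RHS]inE; apply/andP/eqP => [[]|->]; last first.
    by split; [rewrite !inE; apply/orP; right; apply: imset_f|rewrite !inE xe eqxx orbT].
  rewrite !inE => /orP[/eqP->|/imsetP[e' _ ->]]; first by rewrite in_impurity_edge xIc.
  by rewrite !inE eq_sym col_vertex_neq (inj_eq col_vertex_inj) xe => /eqP/m_inj[->].
Qed.

Lemma matching_edges_inj m m' : is_matching I c m -> is_matching I c m' ->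
  matching_edges I c m = matching_edges I c m' -> m =1 m'.
Proof.
move=> [_ mc mI _] [_ mc' mI' _] mm'; case=> [e|[]]; rewrite ?mc ?mc' ?mI ?mI' //.
have : [set of_edge e; col_vertex (m (inl e))] \in matching_edges I c m'.
  by rewrite -mm' !inE; apply/orP; right; apply: imset_f.
rewrite !inE => /orP[/eqP h|/imsetP[e' _ h]].
  by have := edge_notin_impurity e I c; rewrite -h !inE eqxx.
have : of_edge e \in [set of_edge e'; col_vertex (m' (inl e'))] by rewrite -h !inE eqxx.
rewrite !inE col_vertex_neq orbF => /eqP[ee']; move: h; rewrite -ee' => h.
have : col_vertex (m (inl e)) \in [set of_edge e; col_vertex (m' (inl e))].
  by rewrite -h !inE eqxx orbT.
by rewrite !inE eq_sym col_vertex_neq => /eqP/col_vertex_inj.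
Qed.

(** Since the impurity is unique, every other member of [M] contains exactly one [of_edge e], and
    covering that vertex selects the value of [m] at [e]. *)
Lemma perfect_matching_edges M : perfect_matching M -> impurity_edge I c \in M ->
  exists2 m : {ffun W -> X}, is_matching I c m & M = matching_edges I c m.
Proof.
move=> MP IM.
have diagE a : a \in M -> a \in diagonal_edges n p -> a = impurity_edge I c.
  move=> aM ad; have /eqP/cards1P[b bE] := card_impurities MP.
  have : a \in impurities M by rewrite inE aM.
  have : impurity_edge I c \in impurities M.
    by rewrite inE IM; apply/imsetP; exists (I, c); rewrite ?inE.
  by rewrite bE !inE => /eqP-> /eqP->.
have mate e : exists x, incident e x && ([set of_edge e; col_vertex x] \in M).
  have [a aM ea] := perfect_cover (of_edge e) MP.
  have [[e' [x [ex aE]]]|ad] := graph_edge_cases (perfect_subset MP aM); last first.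
    by move: ea; rewrite (diagE a aM ad) !inE => /orP[]/eqP.
  move: ea aM; rewrite aE !inE col_vertex_neq orbF => /eqP[ee'] aM.
  by exists x; rewrite ee' ex.
pose m : {ffun W -> X} := [ffun w => match w with
  | inl e => xchoose (mate e) | inr true => inl I | inr false => inr c end].
have mE e : incident e (m (inl e)) && ([set of_edge e; col_vertex (m (inl e))] \in M).
  by rewrite ffunE; exact: (xchooseP (mate e)).
have not_imp e : m (inl e) != inl I /\ m (inl e) != inr c.
  have /andP[_ eM] := mE e; apply/andP; rewrite -negb_or -in_impurity_edge; apply/negP => eI.
  have h : [set of_edge e; col_vertex (m (inl e))] = impurity_edge I c.
    by apply: (perfect_unique MP eM IM _ eI); rewrite !inE eqxx orbT.
  by have := edge_notin_impurity e I c; rewrite -h !inE eqxx.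
have mI : m (inr true) = inl I by rewrite ffunE.
have mc : m (inr false) = inr c by rewrite ffunE.
exists m.
  split=> // [|e]; last by case/andP: (mE e).
  move=> [e|b] [e'|b'].
  - move=> ee'; have /andP[_ eM] := mE e; have /andP[_ eM'] := mE e'.
    have h := perfect_unique MP eM eM' (v := col_vertex (m (inl e))).
    have : of_edge e \in [set of_edge e'; col_vertex (m (inl e'))].
      by rewrite -h ?inE ?eqxx ?ee' ?eqxx ?orbT.
    by rewrite !inE col_vertex_neq orbF => /eqP[->].
  - by have [/eqP h1 /eqP h2] := not_imp e; case: b'; rewrite ?mI ?mc.
  - by have [/eqP h1 /eqP h2] := not_imp e'; case: b; rewrite ?mI ?mc => /esym.
  - by case: b b' => [] []; rewrite ?mI ?mc.
apply/setP => a; rewrite in_setU1; apply/idP/orP => [aM|[/eqP->//|/imsetP[e _ ->]]]; last first.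
  by case/andP: (mE e).
have [[e [x [ex aE]]]|ad] := graph_edge_cases (perfect_subset MP aM); last first.
  by left; rewrite (diagE a aM ad).
right; apply/imsetP; exists e => //; have /andP[_ eM] := mE e.
by apply: (perfect_unique MP aM eM (v := of_edge e)); rewrite ?aE !inE eqxx.
Qed.

Lemma weight_matchings :
  weight hp I = #|[set M in perfect_matchings n p | impurity_edge I c \in M]|%:R.
Proof.
rewrite (weightE hp Ic); congr (_%:R).
rewrite -(card_in_imset (f := fun m : {ffun W -> X} => matching_edges I c m)).
  apply: eq_card => M; rewrite !inE; apply/imsetP/andP => [[m]|[MP IM]].
    rewrite inE => /matchingP mm ->; split; last by rewrite !inE eqxx.
    exact: matching_edges_perfect.
  have [m mm ->] := perfect_matching_edges MP IM; exists m => //.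
  by rewrite inE; apply/matchingP.
move=> m m'; rewrite !inE => /matchingP mm /matchingP mm' h.
by apply/ffunP => w; exact: (matching_edges_inj mm mm' h).
Qed.

End FromFunction.

Definition degree (I : S) : nat := #|[set c : V | site_corner I c]|.

(** Matchings are sorted by their unique impurity. The weight of [I] is the same for each of its
    corners, which therefore enter only through their number. *)
Lemma card_impurity_in (A : pred (nat * nat)) :
  #|[set M in perfect_matchings n p | impurity_in A M]|%:R =
  \sum_(I : S | A (position I)) (degree I)%:R * weight hp I.
Proof.
transitivity (\sum_(I : S | A (position I)) \sum_(c : V | site_corner I c)
   \sum_(M in perfect_matchings n p) (impurity_edge I c \in M)%:R : rat); last first.
  apply: eq_bigr => I _; rewrite /degree -sum1_card natr_sum mulr_suml.
  rewrite [RHS](eq_bigl (fun c => site_corner I c)); last by move=> c; rewrite inE.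
  apply: eq_bigr => c Ic; rewrite mul1r (weight_matchings Ic) -sum1_card natr_sum.
  rewrite big_mkcond [RHS]big_mkcond; apply: eq_bigr => M _; rewrite !inE.
  by case: (perfect_matching M) => //=; case: (_ \in M).
rewrite -sum1_card natr_sum; under [RHS]eq_bigr => I _ do rewrite exchange_big.
rewrite exchange_big /= big_mkcond [RHS]big_mkcond; apply: eq_bigr => M _.
rewrite !inE; case MP: (perfect_matching M) => //=.
have /eqP/cards1P[b bE] := card_impurities MP.
have : b \in impurities M by rewrite bE set11.
rewrite inE => /andP[bM /imsetP[[I0 c0]]]; rewrite inE /= => Ic0 b0.
have inM I c : site_corner I c -> (impurity_edge I c \in M) = (I == I0) && (c == c0).
  move=> Ic; apply/idP/andP => [IM|[/eqP-> /eqP->]]; last by rewrite /impurity_edge -b0.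
  have : impurity_edge I c \in impurities M.
    by rewrite inE IM; apply/imsetP; exists (I, c); rewrite ?inE.
  by rewrite bE inE b0 => /eqP/impurity_edge_inj[-> ->].
have sumE I : \sum_(c : V | site_corner I c) (impurity_edge I c \in M)%:R = (I == I0)%:R :> rat.
  rewrite (eq_bigr (fun c => (I == I0)%:R * (c == c0)%:R)); last first.
    by move=> c Ic; rewrite inM //; case: (I == I0); rewrite ?mul1r ?mul0r.
  case: (eqVneq I I0) => [->|_]; last by rewrite big1 // => c _; rewrite mul0r.
  by rewrite (bigD1 c0) //= eqxx mul1r big1 ?addr0 // => c /andP[_ /negbTE->]; rewrite mulr0.
rewrite (eq_bigr _ (fun I _ => sumE I)) big_mkcond (bigD1 I0) //= eqxx big1 ?addr0; last first.
  by move=> I /negbTE->; rewrite if_same.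
have -> : impurity_in A M = A (position I0); last by case: (A _).
apply/existsP/idP => [[I /existsP[c]]|AI0].
  by rewrite bE inE b0 => /andP[/eqP/impurity_edge_inj[-> _]].
by exists I0; apply/existsP; exists c0; rewrite AI0 andbT bE inE b0.
Qed.

Lemma degree_gt0 I : (0 < degree I)%N.
Proof.
apply/card_gt0P; case: I => [y|]; first by exists (widen_ord (leqnSn n) y.1, widen_ord (leqnSn p) y.2); rewrite inE face_has_corner.
by exists (ord0, ord0); rewrite inE (terminal_has_corner n hp).
Qed.

Lemma degree_face_le4 y : (degree (Some y) <= 4)%N.
Proof.
pose h (b : bool * bool) : V :=
  (if b.1 then lift ord0 y.1 else widen_ord (leqnSn n) y.1,
   if b.2 then lift ord0 y.2 else widen_ord (leqnSn p) y.2).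
have -> : 4%N = #|{: bool * bool}| by rewrite card_prod card_bool.
apply: leq_trans (leq_imset_card h _); apply: subset_leq_card.
apply/subsetP => -[a b]; rewrite inE /= => /andP[/= ya yb]; apply/imsetP.
exists ((a != y.1 :> nat), (b != y.2 :> nat)) => //.
by congr (_, _); apply: val_inj => /=; case: eqP => [->//|/eqP/negbTE h'] /=;
  [move: ya|move: yb]; rewrite h' => /eqP.
Qed.

End Matchings.

(** * Estimates by test functions *)

(** A geometric series starting at the first power of 2 above [M], hence at most 2; the correction
    [M / 2 ^ K] is the tail that makes the induction close. *)
Lemma dyadic_sum_le (M K : nat) : (0 < M)%N ->
  M%:R * \sum_(k < K) (M < 2 ^ k.+1)%:R / (2 ^ k.+1)%:R <=
    (if (M < 2 ^ K.+1)%N then 2 - M%:R / (2 ^ K)%:R else 0) :> rat.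
Proof.
move=> M0; have pos k : 0 < (2 ^ k)%:R :> rat by rewrite ltr0n expn_gt0.
elim: K => [|K IHK].
  rewrite big_ord0 mulr0 expn0 divr1; case: ltnP => // M2.
  by rewrite subr_ge0 (ler_nat _ M 2); lia.
rewrite big_ord_recr /= mulrDr.
have half : (2 ^ K)%:R = (2 ^ K.+1)%:R / 2 :> rat by rewrite expnS natrM; field.
have halfx : M%:R / (2 ^ K)%:R = 2 * (M%:R / (2 ^ K.+1)%:R) :> rat.
  by rewrite half; field; rewrite gt_eqF.
move: IHK; case: (ltnP M (2 ^ K.+1)) => MK IHK.
  rewrite (leq_trans MK) ?leq_pexp2l //; move: IHK; rewrite halfx mul1r.
  by set x := M%:R / _; lra.
rewrite mul0r mulr0 addr0; case: ltnP => // MK2; apply: le_trans IHK _.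
rewrite subr_ge0 ler_pdivrMr // -natrM ler_nat.
by move: MK2; rewrite (expnS 2 K.+1); lia.
Qed.

Section FaceFunctions.
Variables n p : nat.
Local Notation F := (face n p).

Definition on_faces (u : nat -> nat -> rat) (y : F) : rat := u y.1.+1 y.2.+1.

Lemma ext_on_faces u a b : ext (on_faces u) a b =
  if [&& 0 < a, a <= n, 0 < b & b <= p]%N then u a b else 0.
Proof.
case: ifP => ab; last by rewrite ext_out //; move/negbT: ab; lia.
case: a ab => [|a] //; case: b => [|b] /=; rewrite ?andbF // => /andP[an bp].
exact: (ext_face (on_faces u) (Ordinal an, Ordinal bp)).
Qed.

Lemma laplacianE (w : F -> rat) y : curl (rotor w) y =
  4 * ext w y.1.+1 y.2.+1 - ext w y.1 y.2.+1 - ext w y.1.+2 y.2.+1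
  - ext w y.1.+1 y.2 - ext w y.1.+1 y.2.+2.
Proof. by case: y => i j; rewrite curlE !rotorE /= /bump /= !add1n; ring. Qed.

Lemma ext_on_faces_le u a b : 0 <= u a b -> ext (on_faces u) a b <= u a b.
Proof. by rewrite ext_on_faces; case: ifP. Qed.

End FaceFunctions.

Section Estimates.
Variables (n p : nat) (hp : (0 < p)%N) (hn : (0 < n)%N).
Local Notation F := (face n p).
Local Notation S := (site n p).
Local Notation mu y := (weight hp (Some y : S)).
Local Notation tau := (weight hp (None : S)).

Let t : F := (Ordinal hn, Ordinal hp).

Lemma weight_laplacian_le (u : nat -> nat -> rat) (v : F -> rat) :
  (forall y, v y <= curl (rotor (on_faces u)) y) ->
  \sum_y mu y * v y <= tau * u 1%N 1%N.
Proof.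
move=> uv; rewrite -(weight_laplacian hp (on_faces u) (t := t)) //.
by apply: ler_sum => y _; rewrite ler_wpM2l ?weight_ge0.
Qed.

Lemma weight_laplacian_ge (u : nat -> nat -> rat) (v : F -> rat) :
  (forall y, curl (rotor (on_faces u)) y <= v y) ->
  tau * u 1%N 1%N <= \sum_y mu y * v y.
Proof.
move=> uv; rewrite -(weight_laplacian hp (on_faces u) (t := t)) //.
by apply: ler_sum => y _; rewrite ler_wpM2l ?weight_ge0.
Qed.

(* The test function [a b (N ^ 2 - a b)] has Laplacian [2 a ^ 2 + 2 b ^ 2]. *)
Lemma second_moment_le (N : nat) : (n < N)%N -> (p < N)%N ->
  \sum_y mu y * (2 * (y.1.+1%:R ^+ 2 + y.2.+1%:R ^+ 2)) <= tau * N%:R ^+ 2.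
Proof.
move=> nN pN; pose u (a b : nat) : rat := a%:R * b%:R * (N%:R ^+ 2 - a%:R * b%:R).
have u_ge0 a b : (a <= N)%N -> (b <= N)%N -> 0 <= u a b.
  move=> aN bN; rewrite /u mulr_ge0 ?mulr_ge0 ?ler0n // subr_ge0 expr2.
  by rewrite ler_pM ?ler0n ?ler_nat.
apply: (le_trans (weight_laplacian_le (u := u) _)) => [[i j] /=|]; last first.
  by rewrite ler_wpM2l ?weight_ge0 // /u !mul1r gerBl ler01.
have := ltn_ord i; have := ltn_ord j => jp ip.
rewrite laplacianE /= (ext_face _ (i, j)) /on_faces /=.
(* Replacing nonnegative neighbours outside the grid by 0 only increases the Laplacian. [N] exceeds
   [n] and [p] so that these neighbours are still nonnegative. *)
have le_u a b : (a <= N)%N -> (b <= N)%N -> ext (on_faces (n := n) (p := p) u) a b <= u a b.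
  by move=> aN bN; apply: ext_on_faces_le; exact: u_ge0.
have h1 := le_u i j.+1 ltac:(lia) ltac:(lia).
have h2 := le_u i.+2 j.+1 ltac:(lia) ltac:(lia).
have h3 := le_u i.+1 j ltac:(lia) ltac:(lia).
have h4 := le_u i.+1 j.+2 ltac:(lia) ltac:(lia).
apply: le_trans (lerB (lerB (lerB (lerB (lexx _) h1) h2) h3) h4).
by rewrite /u le_eqVlt; apply/orP; left; apply/eqP; ring.
Qed.

(* The function [a b (m - a) (m - b)] on a box of side [m], continued by 0. *)
Lemma box_first_moment (m : nat) : (0 < m)%N -> (m <= n.+1)%N -> (m <= p.+1)%N ->
  tau * (m%:R - 1) ^+ 2 <=
  \sum_y mu y * ((maxn y.1.+1 y.2.+1 < m)%:R * (4 * m%:R * (maxn y.1.+1 y.2.+1)%:R)).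
Proof.
move=> m0 mn mp.
pose u (a b : nat) : rat :=
  if (a <= m)%N && (b <= m)%N then a%:R * b%:R * (m%:R - a%:R) * (m%:R - b%:R) else 0.
have u_ge0 a b : 0 <= u a b.
  by rewrite /u; case: ifP => // /andP[am bm]; rewrite !mulr_ge0 ?ler0n ?subr_ge0 ?ler_nat.
(* The box may reach one step beyond the grid, where [u] is already 0. *)
have extE a b : ext (on_faces u : F -> rat) a b = u a b.
  rewrite ext_on_faces; case: ifP => // ab; rewrite /u; case: ifP => // abm.
  have : [|| a == 0, b == 0, a == m | b == m]%N by move/negbT: ab; lia.
  by case/or4P=> /eqP->; rewrite ?subrr ?mulr0 ?mul0r.
apply: (le_trans _ (weight_laplacian_ge (u := u) _)) => [|[i j]] /=.
  by rewrite ler_wpM2l ?weight_ge0 // /u m0 /= !mul1r expr2.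
rewrite laplacianE /= !extE; case: ltnP => ijm; rewrite ?mul1r ?mul0r; last first.
  have -> : u i.+1 j.+1 = 0.
    rewrite /u; case: ifP => // /andP[im jm].
    have : (i.+1 == m) || (j.+1 == m) by lia.
    by case/orP=> /eqP->; rewrite subrr ?mulr0 ?mul0r.
  by have := u_ge0 i j.+1; have := u_ge0 i.+2 j.+1; have := u_ge0 i.+1 j;
    have := u_ge0 i.+1 j.+2; lra.
have [im jm] : (i.+1 < m)%N /\ (j.+1 < m)%N by lia.
have uE a b : (a <= m)%N -> (b <= m)%N -> u a b = a%:R * b%:R * (m%:R - a%:R) * (m%:R - b%:R).
  by move=> am bm; rewrite /u am bm.
rewrite !uE; try lia.
have -> : 4 * (i.+1%:R * j.+1%:R * (m%:R - i.+1%:R) * (m%:R - j.+1%:R))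
  - i%:R * j.+1%:R * (m%:R - i%:R) * (m%:R - j.+1%:R)
  - i.+2%:R * j.+1%:R * (m%:R - i.+2%:R) * (m%:R - j.+1%:R)
  - i.+1%:R * j%:R * (m%:R - i.+1%:R) * (m%:R - j%:R)
  - i.+1%:R * j.+2%:R * (m%:R - i.+1%:R) * (m%:R - j.+2%:R) =
  2 * (j.+1%:R * (m%:R - j.+1%:R) + i.+1%:R * (m%:R - i.+1%:R)) :> rat by ring.
have half (a : nat) : (a <= maxn i.+1 j.+1)%N ->
    a%:R * (m%:R - a%:R) <= m%:R * (maxn i.+1 j.+1)%:R :> rat.
  move=> a1; rewrite [leRHS]mulrC; apply: ler_pM; rewrite ?ler0n ?ler_nat //.
    by rewrite subr_ge0 ler_nat; lia.
  by rewrite gerBl ler0n.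
by have := half i.+1 (leq_maxl _ _); have := half j.+1 (leq_maxr _ _); lra.
Qed.

(** Each of the [K] boxes of sides 2, 4, ..., [2 ^ K] yields [tau / 4], while over all boxes a face
    is counted with total factor at most 4 * 2 by [dyadic_sum_le]; hence 32. *)
Lemma weight_sum_ge (K : nat) : (2 ^ K <= n.+1)%N -> (2 ^ K <= p.+1)%N ->
  tau * K%:R <= 32 * \sum_y mu y.
Proof.
move=> Kn Kp.
have box (k : 'I_K) : tau / 4 <= \sum_y mu y * ((maxn y.1.+1 y.2.+1 < 2 ^ k.+1)%:R
    * (4 * (maxn y.1.+1 y.2.+1)%:R) / (2 ^ k.+1)%:R).
  have kK : (2 ^ k.+1 <= 2 ^ K)%N by rewrite leq_pexp2l.
  have m0 : (0 < 2 ^ k.+1)%N by rewrite expn_gt0.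
  have m2 : (2 <= 2 ^ k.+1)%N by rewrite -{1}(expn1 2) leq_pexp2l.
  have := box_first_moment m0 (leq_trans kK Kn) (leq_trans kK Kp).
  set m := (2 ^ k.+1)%N in m0 m2 *; have m0' : 0 < m%:R :> rat by rewrite ltr0n.
  have m2' : 2 <= m%:R :> rat by rewrite (ler_nat _ 2).
  rewrite -(ler_pM2r (x := m%:R^-1 ^+ 2)) ?exprn_gt0 ?invr_gt0 // mulr_suml.
  rewrite (eq_bigr (fun y : F => mu y * ((maxn y.1.+1 y.2.+1 < m)%:R
    * (4 * (maxn y.1.+1 y.2.+1)%:R) / m%:R))); last first.
    by move=> y _; field; rewrite gt_eqF.
  move=> hb; apply: le_trans hb; rewrite -[leRHS]mulrA ler_wpM2l ?weight_ge0 // -exprMn.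
  (* Sides start at 2; squaring this bound gives the 1/4. *)
  have h : 1 / 2 <= (m%:R - 1) * m%:R^-1 :> rat.
    by rewrite ler_pdivlMr //; lra.
  by apply: le_trans (lerXn2r 2 _ _ h) => //; rewrite ?nnegrE; lra.
have : \sum_(k < K) tau / 4 <= 8 * \sum_y mu y.
  apply: le_trans (ler_sum _ (fun k _ => box k)) _.
  rewrite exchange_big mulr_sumr; apply: ler_sum => y _.
  rewrite -mulr_sumr [leRHS]mulrC ler_wpM2l ?weight_ge0 //.
  set M := maxn _ _; have M0 : (0 < M)%N by rewrite /M; lia.
  have := dyadic_sum_le K M0; set s := \sum_(k < K) _ => sM.
  have -> : \sum_(k < K) (M < 2 ^ k.+1)%:R * (4 * M%:R) / (2 ^ k.+1)%:R = 4 * (M%:R * s) :> rat.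
    by rewrite mulrA mulr_sumr; apply: eq_bigr => k _; rewrite mulrCA mulrAC -mulrA; ring.
  have : M%:R * s <= 2; last lra.
  apply: le_trans sM _; case: ifP => // _; rewrite gerBl divr_ge0 ?ler0n //.
by rewrite sumr_const card_ord -mulr_natr; lra.
Qed.

Lemma card_perfect_ge :
  tau + \sum_y mu y <= #|perfect_matchings n p|%:R.
Proof.
have -> : #|perfect_matchings n p| = #|[set M in perfect_matchings n p | impurity_in predT M]|.
  apply: eq_card => M; rewrite !inE; case MP: (perfect_matching M) => //=.
  have /eqP/cards1P[b bE] := card_impurities MP; have : b \in impurities M by rewrite bE set11.
  rewrite inE => /andP[bM bd]; have := bd; case/imsetP=> -[I c] _ /= bI.
  by apply/esym/existsP; exists I; apply/existsP; exists c; rewrite andbT inE -bI bM.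
rewrite (card_impurity_in n hp) /= -sum_option /=; apply: ler_sum => I _.
by rewrite ler_peMl ?weight_ge0 // (ler_nat _ 1) degree_gt0.
Qed.

(** [A0] excludes the terminal, whose weight the moment bounds do not control; 4 bounds the number
    of corners of a face. *)
Lemma card_face_event (A : pred (nat * nat)) : A (0, 1)%N = false ->
  #|[set M in perfect_matchings n p | impurity_in A M]|%:R <=
  4 * \sum_(y : F | A (y.1.+1, y.2.+1)) mu y.
Proof.
move=> A0; rewrite (card_impurity_in n hp) big_mkcond sum_option /= A0 add0r.
rewrite [X in _ * X]big_mkcond mulr_sumr; apply: ler_sum => -[i j] _ /=.
case: ifP => _; last by rewrite mulr0.
by rewrite ler_wpM2r ?weight_ge0 // (ler_nat _ _ 4) degree_face_le4.
Qed.

End Estimates.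

(** Markov's inequality for the second moment with [N = n + 1]: as [(n + 1) ^ 2 <= 4 * n ^ 2], the
    far faces have mass at most [2 * j ^ 2 * tau]. The factors 4 for corners and 32 from
    [weight_sum_ge] make 256. *)
Lemma far_event_square (n K j : nat) (A : pred (nat * nat)) :
  (0 < n)%N -> (2 ^ K <= n.+1)%N -> A (0, 1)%N = false ->
  (forall a b, A (a, b) -> n ^ 2 <= j ^ 2 * (a ^ 2 + b ^ 2))%N ->
  (#|[set M in perfect_matchings n n | impurity_in A M]| * K
     <= 256 * j ^ 2 * #|perfect_matchings n n|)%N.
Proof.
move=> hn Kn A0 Afar; rewrite -(ler_nat rat) !natrM.
set c := #|[set M in _ | _]|; set tot := #|perfect_matchings n n|.
have hc : c%:R <= _ := card_face_event n hn A0.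
have h1 := second_moment_le hn hn (ltnSn n) (ltnSn n).
have h2 := weight_sum_ge hn hn Kn Kn.
have h3 : _ <= tot%:R := card_perfect_ge n hn.
set tau := weight hn None in h1 h2 h3; set s := \sum_y _ in h2 h3.
have tau0 : 0 <= tau by exact: weight_ge0.
set sA := \sum_(y | _) _ in hc.
have hA : sA * n%:R ^+ 2 * 2 <= j%:R ^+ 2 * (tau * n.+1%:R ^+ 2).
  apply: le_trans (ler_wpM2l _ h1); last by rewrite exprn_ge0 ?ler0n.
  rewrite /sA !mulr_suml mulr_sumr big_mkcond /=; apply: ler_sum => y _.
  have mu0 := weight_ge0 hn (Some y).
  case: ifP => [/Afar yA|_]; last by rewrite !mulr_ge0 ?addr_ge0 ?exprn_ge0 ?ler0n.
  move: yA; rewrite -(ler_nat rat) natrM natrD !natrX => yA.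
  have := ler_wpM2l mu0 yA; lra.
have hn1 : n.+1%:R ^+ 2 <= 4 * n%:R ^+ 2 :> rat.
  by rewrite -natrX -natrX -natrM ler_nat; nia.
have n0 : 0 < n%:R ^+ 2 :> rat by rewrite exprn_gt0 ?ltr0n.
have hA2 : sA * 2 <= j%:R ^+ 2 * tau * 4.
  rewrite -(ler_pM2r n0); apply: le_trans (_ : j%:R ^+ 2 * (tau * n.+1%:R ^+ 2) <= _).
    by move: hA; lra.
  rewrite -[leRHS]mulrA mulrA ler_wpM2l ?mulr_ge0 ?exprn_ge0 ?ler0n //.
have hcj : c%:R <= 8 * j%:R ^+ 2 * tau by lra.
apply: le_trans (ler_wpM2r (ler0n _ K) hcj) _.
have : tau * K%:R <= 32 * tot%:R by lra.
move/(ler_wpM2l (_ : 0 <= 8 * j%:R ^+ 2 :> rat)) => h.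
rewrite -[leLHS]mulrA; apply: le_trans (h _) _; first by rewrite mulr_ge0 ?exprn_ge0 ?ler0n.
by lra.
Qed.

Lemma far_event_chain (n j : nat) (A : pred (nat * nat)) :
  (0 < n)%N -> A (0, 1)%N = false -> (forall a b, A (a, b) -> n <= j * a)%N ->
  (#|[set M in perfect_matchings n 1 | impurity_in A M]| * n
     <= 2 * j * #|perfect_matchings n 1|)%N.
Proof.
move=> hn A0 Afar; rewrite -(ler_nat rat) !natrM.
set c := #|[set M in _ | _]|; set tot := #|perfect_matchings n 1|.
pose hp : (0 < 1)%N := isT.
have hc : c%:R <= _ := card_face_event n hp A0.
have h3 : _ <= tot%:R := card_perfect_ge n hp.
(* The faces above and below a chain are killed, so the linear function [a] has Laplacian at least
   [2 * a], and its value at [t] does not grow with [n]. *)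
have h1 : \sum_(y : face n 1) weight hp (Some y) * (2 * y.1.+1%:R) <= weight hp (None : site n 1).
  have := weight_laplacian_le hp hn (u := fun a _ => a%:R)
    (v := fun y : face n 1 => 2 * y.1.+1%:R); rewrite mulr1; apply => -[i j'].
  rewrite (ord1 j') laplacianE /= !ext_on_faces /=.
  have i0 : 0 <= i%:R :> rat by rewrite ler0n.
  rewrite ltn_ord !andbF !subr0 /=.
  by case: ifP => _; case: ifP => _; rewrite -?natr1; lra.
set tau := weight _ None in h1 h3; set s := \sum_y _ in h3.
have s0 : 0 <= s by apply: sumr_ge0 => y _; exact: weight_ge0.
set sA := \sum_(y | _) _ in hc.
have hA : sA * n%:R * 2 <= j%:R * tau.
  apply: le_trans (ler_wpM2l _ h1); last by rewrite ler0n.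
  rewrite /sA !mulr_suml mulr_sumr big_mkcond /=; apply: ler_sum => y _.
  have mu0 := weight_ge0 hp (Some y).
  case: ifP => [/Afar yA|_]; last by rewrite !mulr_ge0 ?ler0n.
  move: yA; rewrite -(ler_nat rat) natrM => yA.
  have := ler_wpM2l mu0 yA; lra.
apply: le_trans (ler_wpM2r (ler0n _ n) hc) _.
have : j%:R * tau <= j%:R * tot%:R by rewrite ler_wpM2l ?ler0n //; lra.
by lra.
Qed.

(** * From counts to probabilities *)

Section Probabilities.
Variable R : realFieldType.

Lemma card_perfect_gt0 n p : (0 < p)%N -> (0 < #|perfect_matchings n p|)%N.
Proof.
move=> hp; rewrite -(ltr_nat rat); apply: lt_le_trans (card_perfect_ge n hp).
by rewrite ltr_wpDr ?sumr_ge0 ?weight_terminal_gt0 // => y _; exact: weight_ge0.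
Qed.

Lemma matching_prob_ge0 n p (B : pred {set {set vertex n p}}) : 0 <= matching_prob R B.
Proof. by rewrite /matching_prob divr_ge0 ?ler0n. Qed.

Lemma matching_prob_le1 n p (B : pred {set {set vertex n p}}) : matching_prob R B <= 1.
Proof.
rewrite /matching_prob; case: (posnP #|perfect_matchings n p|) => [->|t0].
  by rewrite invr0 mulr0.
rewrite ler_pdivrMr ?ltr0n // mul1r ler_nat subset_leq_card //.
by apply/subsetP => M; rewrite inE => /andP[].
Qed.

Lemma matching_prob_predC n p (A : pred (nat * nat)) : (0 < p)%N ->
  1 - matching_prob R (@impurity_in n p (predC A)) <= matching_prob R (@impurity_in n p A).
Proof.
move=> hp; have t0 := card_perfect_gt0 n hp; rewrite lerBlDr /matching_prob -mulrDl.
rewrite ler_pdivlMr ?ltr0n // mul1r -natrD ler_nat.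
apply: leq_trans (leq_card_setU _ _); apply: subset_leq_card; apply/subsetP => M MP.
rewrite in_setU !inE; move: (MP); rewrite inE => ->.
rewrite -[_ || _]/(impurity_in A M || impurity_in (predC A) M).
move: MP; rewrite inE => MP; have /eqP/cards1P[b bE] := card_impurities MP.
have := set11 b; rewrite -bE => bM; have := bM; rewrite inE => /andP[_ /imsetP[[I c] _ bI]].
case AI: (A (position I)); apply/orP; [left|right]; apply/existsP; exists I;
  by apply/existsP; exists c; rewrite -bI bM //= AI.
Qed.

Lemma prob_far_square n K j (A : pred (nat * nat)) :
  (0 < n)%N -> (2 ^ K <= n.+1)%N -> A (0, 1)%N = false ->
  (forall a b, A (a, b) -> n ^ 2 <= j ^ 2 * (a ^ 2 + b ^ 2))%N ->
  matching_prob R (@impurity_in n n A) * K%:R <= (256 * j ^ 2)%:R.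
Proof.
move=> hn hK A0 Afar; rewrite /matching_prob mulrAC ler_pdivrMr ?ltr0n ?card_perfect_gt0 //.
by rewrite -!natrM ler_nat far_event_square.
Qed.

Lemma prob_far_chain n j (A : pred (nat * nat)) :
  (0 < n)%N -> A (0, 1)%N = false -> (forall a b, A (a, b) -> n <= j * a)%N ->
  matching_prob R (@impurity_in n 1 A) * n%:R <= (2 * j)%:R.
Proof.
move=> hn A0 Afar; rewrite /matching_prob mulrAC ler_pdivrMr ?ltr0n ?card_perfect_gt0 //.
by rewrite -!natrM ler_nat far_event_chain.
Qed.

End Probabilities.

(** * Limits *)

From mathcomp Require Import all_classical all_reals all_analysis.
Import numFieldNormedType.Exports.
Local Open Scope classical_set_scope.
Local Open Scope ring_scope.

Section Limits.
Variable R : realType.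

Lemma archi_mul (e : R) : 0 < e -> exists j : nat, 1 <= e * j%:R.
Proof.
move=> e0; exists (Num.bound e^-1).
by rewrite -ler_pdivrMl // mulr1 ltW // archi_boundP // invr_ge0 ltW.
Qed.

(** Each [K] is fixed before [n] grows, so the logarithmic rate never has to be written down. *)
Lemma cvg0_bounded_mul (u : nat -> R) (C : R) : (forall n, 0 <= u n) ->
  (forall K : nat, \forall n \near \oo, u n * K%:R <= C) -> u n @[n --> \oo] --> 0.
Proof.
move=> u0 uC; apply/cvgr0Pnorm_le => e e0.
pose K := (Num.bound (`|C| / e)).+1; have K0 : 0 < K%:R :> R by rewrite ltr0n.
have CK : C <= e * K%:R.
  apply: le_trans (ler_norm C) _; rewrite -ler_pdivrMl // mulrC ltW //.
  apply: lt_trans (archi_boundP (divr_ge0 (normr_ge0 _) (ltW e0))) _.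
  by rewrite ltr_nat.
near=> n; rewrite ger0_norm // -(ler_pM2r K0); apply: le_trans CK.
by near: n; exact: uC.
Unshelve. all: by end_near. Qed.

Lemma cvg1_predC (p : nat -> nat) (A : nat -> pred (nat * nat)) :
  (\forall n \near \oo, (0 < p n)%N) ->
  matching_prob R (@impurity_in n (p n) (predC (A n))) @[n --> \oo] --> (0 : R) ->
  matching_prob R (@impurity_in n (p n) (A n)) @[n --> \oo] --> (1 : R).
Proof.
move=> p0 Ac; apply: (squeeze_cvgr (f := fun n => 1 - matching_prob R (@impurity_in n (p n) (predC (A n)))) (h := fun=> 1)).
- near=> n; rewrite matching_prob_le1 andbT; apply: matching_prob_predC.
  by near: n.
- by rewrite -[X in _ --> X](subr0 1); apply: cvgB => //; exact: cvg_cst.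
- exact: cvg_cst.
Unshelve. all: by end_near. Qed.

Lemma cvg0_square (A : nat -> pred (nat * nat)) (j : nat) :
  (\forall n \near \oo, A n (0, 1)%N = false /\
    forall a b, A n (a, b) -> (n ^ 2 <= j ^ 2 * (a ^ 2 + b ^ 2))%N) ->
  matching_prob R (@impurity_in n n (A n)) @[n --> \oo] --> (0 : R).
Proof.
move=> Afar; apply: (@cvg0_bounded_mul _ (256 * j ^ 2)%:R) => [n|K].
  exact: matching_prob_ge0.
near=> n; have [A0 An] : A n (0, 1)%N = false /\
    forall a b, A n (a, b) -> (n ^ 2 <= j ^ 2 * (a ^ 2 + b ^ 2))%N by near: n.
by apply: prob_far_square => //; [near: n; exact: nbhs_infty_gt
  |apply: leqW; near: n; exact: nbhs_infty_ge].
Unshelve. all: by end_near. Qed.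

Lemma cvg0_chain (A : nat -> pred (nat * nat)) (j : nat) :
  (\forall n \near \oo, A n (0, 1)%N = false /\
    forall a b, A n (a, b) -> (n <= j * a)%N) ->
  matching_prob R (@impurity_in n 1 (A n)) @[n --> \oo] --> (0 : R).
Proof.
move=> Afar; apply: (@cvg0_bounded_mul _ (2 * j)%:R) => [n|K].
  exact: matching_prob_ge0.
near=> n; have [A0 An] : A n (0, 1)%N = false /\
    forall a b, A n (a, b) -> (n <= j * a)%N by near: n.
apply: le_trans (prob_far_chain R (n := n) (j := j) _ A0 An).
  by rewrite ler_wpM2l ?matching_prob_ge0 // ler_nat; near: n; exact: nbhs_infty_ge.
by near: n; exact: nbhs_infty_gt.
Unshelve. all: by end_near. Qed.

Lemma le_mul_of_scaled (e : R) (j n a : nat) : 1 <= e * j%:R -> e * n%:R <= a%:R ->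
  (n <= j * a)%N.
Proof.
move=> ej en; rewrite -(ler_nat R) natrM.
apply: le_trans (ler_wpM2l (ler0n R j) en); rewrite mulrA ler_peMl ?ler0n //.
by rewrite mulrC.
Qed.

Lemma dirac_box (c1 c2 d1 d2 : R) : 0 <= c1 -> c1 < c2 -> 0 <= d1 -> d1 < d2 ->
  (\d_((0, 0) : R * R) (`[c1, c2] `*` `[d1, d2]) : \bar R) =
  ((c1 == 0) && (d1 == 0))%:R%:E.
Proof.
move=> c1ge c12 d1ge d12; rewrite diracE; congr (_%:R%:E); congr (nat_of_bool _).
apply/idP/andP; rewrite inE /= !in_itv /= => -[].
  by move=> /andP[c1le _] /andP[d1le _]; rewrite !eq_le c1le c1ge d1le d1ge.
by move=> /eqP c10 /eqP d10; rewrite c10 d10 !lexx /= -{1}c10 -d10 !ltW.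
Qed.

Lemma dirac_itv (c1 c2 : R) : 0 <= c1 -> c1 < c2 ->
  (\d_(0 : R) `[c1, c2] : \bar R) = (c1 == 0)%:R%:E.
Proof.
move=> c1ge c12; rewrite diracE; congr (_%:R%:E); congr (nat_of_bool _).
apply/idP/idP; rewrite inE /= in_itv /=.
  by move=> /andP[c1le _]; rewrite eq_le c1le c1ge.
by move=> /eqP c10; rewrite c10 lexx /= -c10 ltW.
Qed.

Lemma cvg_EFin_seq (u : nat -> R) (l : R) :
  u n @[n --> \oo] --> l -> (u n)%:E @[n --> \oo] --> l%:E.
Proof. by move=> ul; apply: cvg_EFin => //; exact: nearW. Qed.

End Limits.

Theorem theorem1p4 (R : realType) :
  (forall c1 c2 d1 d2 : R,
     0 <= c1 -> c1 < c2 -> c2 <= 1 -> 0 <= d1 -> d1 < d2 -> d2 <= 1 ->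
     (matching_prob R (@impurity_in n n (fun z =>
        (z.1%:R \in `[c1 * n%:R, c2 * n%:R]) &&
        (z.2%:R \in `[d1 * n%:R, d2 * n%:R]))))%:E @[n --> \oo]
     --> (\d_((0, 0) : R * R) (`[c1, c2] `*` `[d1, d2]) : \bar R)) /\
  (forall c1 c2 : R, 0 <= c1 -> c1 < c2 -> c2 <= 1 ->
     (matching_prob R (@impurity_in n 1 (fun z =>
        z.1%:R \in `[c1 * n%:R, c2 * n%:R])))%:E @[n --> \oo]
     --> (\d_(0 : R) `[c1, c2] : \bar R)).
Proof.
split=> [c1 c2 d1 d2 c1ge c12 _ d1ge d12 _|c1 c2 c1ge c12 _].
- rewrite dirac_box //; apply: cvg_EFin_seq.
  pose A (n : nat) (z : nat * nat) := (z.1%:R \in `[c1 * n%:R, c2 * n%:R]) &&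
    (z.2%:R \in `[d1 * n%:R, d2 * n%:R]).
  have far_l n j (e : R) (a b : nat) : 1 <= e * j%:R -> e * n%:R <= a%:R ->
      (n ^ 2 <= j ^ 2 * (a ^ 2 + b ^ 2))%N.
    by move=> ej /(le_mul_of_scaled ej); rewrite mulnDr -!expnMn -leq_sqr; lia.
  have far_r n j (e : R) (a b : nat) : 1 <= e * j%:R -> e * n%:R <= b%:R ->
      (n ^ 2 <= j ^ 2 * (a ^ 2 + b ^ 2))%N.
    by rewrite addnC; exact: far_l.
  (* If [c1] or [d1] is positive, the event lies at distance of order [n] and has limit 0; otherwise
     its complement does. *)
  have [c1z|c1z] := eqVneq c1 0; last first.
    have c10 : 0 < c1 by rewrite lt_neqAle eq_sym c1z.
    have [j cj] := archi_mul c10; apply: (@cvg0_square R A j); near=> n; split.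
      apply/negbTE; rewrite /A !in_itv /=; apply/nandP; left; apply/nandP; left.
      by rewrite -ltNge mulr_gt0 // ltr0n; near: n; exact: nbhs_infty_gt.
    by move=> a b; rewrite /A !in_itv /= => /andP[/andP[ca _] _]; exact: far_l ca.
  have [d1z|d1z] := eqVneq d1 0; last first.
    have d10 : 0 < d1 by rewrite lt_neqAle eq_sym d1z.
    have [j dj] := archi_mul d10; apply: (@cvg0_square R A j); near=> n; split.
      apply/negbTE; rewrite /A !in_itv /=; apply/nandP; right; apply/nandP; left.
      (* The terminal has second coordinate 1, so it leaves the event only once [d1 * n] exceeds 1,
         which holds for [n > j]. *)
      rewrite -ltNge; apply: le_lt_trans dj _; rewrite ltr_pM2l // ltr_nat.
      by near: n; exact: nbhs_infty_gt.
    by move=> a b; rewrite /A !in_itv /= => /andP[_ /andP[db _]]; exact: far_r db.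
  apply: (@cvg1_predC R id A); first exact: nbhs_infty_gt.
  rewrite c1z in c12; rewrite d1z in d12.
  have [i ci] := archi_mul c12; have [j dj] := archi_mul d12.
  have cm : 1 <= c2 * (maxn i j)%:R.
    by apply: le_trans ci _; rewrite ler_pM2l // ler_nat leq_maxl.
  have dm : 1 <= d2 * (maxn i j)%:R.
    by apply: le_trans dj _; rewrite ler_pM2l // ler_nat leq_maxr.
  apply: (@cvg0_square R (fun n => predC (A n)) (maxn i j)); near=> n; split.
    (* The complement must miss the terminal at (0, 1), which needs [1 <= d2 * n]. *)
    apply/negbTE; rewrite /= negbK /A !in_itv /= c1z d1z !mul0r lexx /= ler01 /=.
    rewrite mulr_ge0 ?(ltW c12) // (le_trans dj) // ler_pM2l // ler_nat.
    by near: n; exact: nbhs_infty_ge.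
  move=> a b; rewrite /= /A !in_itv /= c1z d1z !mul0r !ler0n /= negb_and -!ltNge.
  by case/orP=> /ltW h; [exact: far_l h|exact: far_r h].
- rewrite dirac_itv //; apply: cvg_EFin_seq.
  pose A (n : nat) (z : nat * nat) := z.1%:R \in `[c1 * n%:R, c2 * n%:R].
  have [c1z|c1z] := eqVneq c1 0; last first.
    have c10 : 0 < c1 by rewrite lt_neqAle eq_sym c1z.
    have [j cj] := archi_mul c10; apply: (@cvg0_chain R A j); near=> n; split.
      apply/negbTE; rewrite /A in_itv /=; apply/nandP; left.
      by rewrite -ltNge mulr_gt0 // ltr0n; near: n; exact: nbhs_infty_gt.
    by move=> a b; rewrite /A in_itv /= => /andP[ca _]; exact: le_mul_of_scaled ca.
  apply: (@cvg1_predC R (fun=> 1%N) A); first exact: nearW.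
  rewrite c1z in c12; have [j cj] := archi_mul c12.
  apply: (@cvg0_chain R (fun n => predC (A n)) j); near=> n; split.
    by apply/negbTE; rewrite /= negbK /A in_itv /= c1z mul0r lexx mulr_ge0 // ltW.
  move=> a b; rewrite /= /A in_itv /= c1z mul0r ler0n /= -ltNge => /ltW.
  exact: le_mul_of_scaled.
Unshelve. all: by end_near. Qed.
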